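(* Let $E/\mathbb{Q}$ be a finite Galois extension, $G=\mathrm{Gal}(E/\mathbb{Q})$, and let $Q\in 1+zR(G)[[z]]$ be a power series, where $R(G)$ is the ring of complex linear combinations of irreducible characters of $G$. Let $b_{n,\rho}=b_{n,\rho}(Q)$ be the unique sequence of complex numbers, indexed by positive integers $n$ and irreducible complex representations $\rho$ of $G$ (up to isomorphism), such that $$\log Q = -\sum_{n=1}^\infty\sum_{\rho} b_{n,\rho}\log\det(I-\rho z^n)\quad\text{in } zR(G)[[z]].$$ Then the following hold: (i) Write $\log Q=\sum_{n\ge 1}\sum_{\rho} q_{n,\rho}\,\mathrm{tr}\rho\; z^n$ with $q_{n,\rho}\in\mathbb{C}$, and define the sequence $r_{n,\rho}$ recursively by $r_{1,\rho}=q_{1,\rho}$ for each $\rho$ and, for $n>1$, $$r_{n,\rho}=q_{n,\rho}-\sum_{\substack{d\mid n\\ d>1}}\ \sum_{\gamma\text{ irrep.}}\frac{\langle\gamma^{\otimes d},\rho\rangle}{d}\,r_{n/d,\gamma}$$ for each $\rho$. Then $$b_{n,\rho}=\sum_{d\mid n}\ \sum_{\gamma\text{ irrep.}}\langle\gamma^{\otimes_{\mathrm{cyc}}d},\rho\rangle\, r_{n/d,\gamma},$$ where $\gamma^{\otimes_{\mathrm{cyc}}d}$ is the cyclic tensor power of $\gamma$ by $d$. (ii) If $Q\in 1+zR(G,\mathbb{Z})[[z]]$, where $R(G,\mathbb{Z})\subseteq R(G)$ is the set of integer linear combinations of the irreducible characters, then $b_{n,\rho}\in\mathbb{Z}$ for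 all $n,\rho$.
   Context: $R(G)$ is identified with the ring of complex class functions on $G$ under pointwise operations. For a representation $\rho:G\to\mathrm{GL}(V)$, $\mathrm{tr}\rho\in R(G)$ is its character $g\mapsto \mathrm{tr}\rho(g)$, and $-\log\det(I-\rho z^n)\in zR(G)[[z]]$ is the series whose value at $g\in G$ is $-\log\det(I-\rho(g)z^n)=\sum_{k\ge1}\mathrm{tr}\rho(g^k)z^{kn}/k$. Logarithms are formal and infinite sums converge $z$-adically. Evaluating at a Frobenius element $g=\mathrm{Fr}_p$ gives the power series $Q_p(z)$ attached to an unramified prime $p$. The existence and uniqueness of $b_{n,\rho}$ is known. For representations $\varphi,\gamma$ of $G$ with $\gamma$ irreducible, $\langle\varphi,\gamma\rangle$ is the standard inner product of characters, i.e. the multiplicity of $\gamma$ in $\varphi$. Sums over $\gamma$ run over isomorphism classes of irreducible complex representations of $G$. Cyclic tensor power: for a finite-dimensional complex representation $\rho:G\to \mathrm{GL}(V)$ and a positive integer $n$, fix a primitive $n$th root of unity $\zeta$ and let $\mathbb{Z}/n\mathbb{Z}$ act linearly on $V^{\otimes n}$ by $m.(a_1\otimes\cdots\otimes a_n)=a_{1+m}\otimes\cdots\otimes a_{n+m}$ (indices modulo $n$). Let $V^{\otimes_{\mathrm{cyc}}n}$ be the quotient of $V^{\otimes n}$ by the subspace spanned by all $\zeta^m v-m.v$ with $m\in\mathbb{Z}/n\mathbb{Z}$, $v\in V^{\otimes n}$. Then $\rho^{\otimes_{\mathrm{cyc}}n}:G\to\mathrm{GL}(V^{\otimes_{\mathrm{cyc}}n})$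 is the representation induced on this quotient by $\rho^{\otimes n}$; its isomorphism class does not depend on $\zeta$. *)

(* Defs.v *)
From HB Require Import structures.
From mathcomp Require Import all_boot all_order all_algebra all_fingroup.
From mathcomp Require Import all_field mxrepresentation.
From mathcomp Require Import reals.
From mathcomp Require Export complex.

Set Implicit Arguments.
Unset Strict Implicit.
Unset Printing Implicit Defensive.

Import Order.TTheory GroupScope GRing.Theory Num.Theory.
Local Open Scope ring_scope.

(* A formal power series is the sequence of its coefficients.                 *)

Section ZAdic.

Variable A : zmodType.

(* [zseries F f] : the sum over n >= 1 of the series F n converges z-adically *)
(* to f, i.e. modulo every z^m the partial sums are eventually equal to f.    *)
Definition zseries (F : nat -> nat -> A) (f : nat -> A) : Prop :=
  forall m, exists N0, forall N, (N0 <= N)%N -> forall k, (k < m)%N ->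
    \sum_(1 <= n < N.+1) F n k = f k.

End ZAdic.

Section PowerSeries.

Variable F : fieldType.

Definition ps_mul (f g : nat -> F) : nat -> F :=
  fun n => \sum_(i < n.+1) f i * g (n - i)%N.

Definition ps_one : nat -> F := fun n => (n == 0%N)%:R.

Definition ps_exp (f : nat -> F) (k : nat) : nat -> F :=
  iter k (ps_mul f) ps_one.

Definition ps_log_term (f : nat -> F) (k : nat) : nat -> F :=
  fun n => (-1) ^+ k.-1 / k%:R * ps_exp (fun j => f j - ps_one j) k n.

(* The Mercator series; if f has constant term 1, then (f - 1)^k does not     *)
(* contribute to the coefficient of z^n for k > n (see ps_logP).              *)
Definition ps_log (f : nat -> F) : nat -> F :=
  fun n => \sum_(1 <= k < n.+1) ps_log_term f k n.

Lemma ps_exp_val (f : nat -> F) k n :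
  f 0%N = 0 -> (n < k)%N -> ps_exp f k n = 0.
Proof.
move=> f0; elim: k n => // k IHk n ltnk.
rewrite /ps_exp iterS /ps_mul big1 // => -[[|i] lti] _ /=.
  by rewrite f0 mul0r.
rewrite [iter _ _ _ _]IHk ?mulr0 //.
rewrite (leq_trans _ (ltnk : (n <= k)%N)) // ltn_subrL /=.
exact: leq_ltn_trans (leq0n i) lti.
Qed.

Lemma ps_logP (f : nat -> F) :
  f 0%N = 1 -> zseries (ps_log_term f) (ps_log f).
Proof.
move=> f0 m; exists m => N lemN k ltkm; rewrite /ps_log.
have leNk : (k.+1 <= N.+1)%N by rewrite ltnS (leq_trans (ltnW ltkm)).
rewrite (big_cat_nat (n := k.+1)) //= [X in _ + X]big_nat_cond [X in _ + X]big1 ?addr0 //.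
move=> j /andP[/andP[ltkj _] _]; rewrite /ps_log_term ps_exp_val ?mulr0 //.
by rewrite f0 /ps_one eqxx subrr.
Qed.

End PowerSeries.

Section TensorPower.

Variables (F : fieldType) (m n : nat).

(* The tensor power of order n of V = F^m (row vectors, acted on from the     *)
(* right) has the basis of the e_(f 0) (x) ... (x) e_(f (n-1)), indexed by    *)
(* the functions f : 'I_n -> 'I_m.                                            *)
Notation tens_dim := #|{ffun 'I_n -> 'I_m}|.

Local Notation idx i := (enum_val i : {ffun 'I_n -> 'I_m}).

Definition pure_tensor (a : 'I_n -> 'rV[F]_m) : 'rV[F]_tens_dim :=
  \row_i \prod_k a k 0 (idx i k).

Definition tens_mx (A : 'M[F]_m) : 'M[F]_tens_dim :=
  \matrix_(i, j) \prod_k A (idx i k) (idx j k).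

Definition cyc_shift (k : nat) (l : 'I_n) : 'I_n := iter k (@ordS n) l.

(* e_f is sent to e_(f o shift^k); see pure_tensor_cyc.                       *)
Definition cyc_mx (k : nat) : 'M[F]_tens_dim :=
  \matrix_(i, j) (idx j == [ffun l => idx i (cyc_shift k l)])%:R.

Lemma sum_tens_basis (T : nmodType) (g : {ffun 'I_n -> 'I_m} -> T) :
  \sum_(i < tens_dim) g (idx i) = \sum_f g f.
Proof.
by rewrite (reindex _ (onW_bij _ (@enum_val_bij {ffun 'I_n -> 'I_m}))) /=.
Qed.

Lemma pure_tensorM a A :
  pure_tensor a *m tens_mx A = pure_tensor (fun k => a k *m A).
Proof.
apply/rowP => j; rewrite !mxE.
under [LHS]eq_bigr => i _ do rewrite !mxE -big_split /=.
rewrite (sum_tens_basis (fun f : {ffun 'I_n -> 'I_m} =>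
  \prod_k (a k 0 (f k) * A (f k) (idx j k)))).
rewrite -(bigA_distr_bigA (fun k l => a k 0 l * A l (idx j k))).
by apply: eq_bigr => k _; rewrite mxE.
Qed.

Lemma cyc_shift_bij k : bijective (cyc_shift k).
Proof.
by elim: k => [|k IHk]; [exists id | apply: bij_comp IHk; exists (@ord_pred n);
  [exact: ordSK | exact: ord_predK]].
Qed.

Lemma cyc_shift_val k l : cyc_shift k l = ((l + k) %% n)%N :> nat.
Proof.
elim: k => [|k IHk]; first by rewrite addn0 modn_small.
by rewrite /cyc_shift iterS /= -/(cyc_shift k l) IHk -addn1 modnDml addn1 addnS.
Qed.

Lemma tens_mx1 : tens_mx 1%:M = 1%:M.
Proof.
apply/matrixP => i j; rewrite !mxE.
have [<-|neq_ij] := eqVneq i j; first by rewrite big1 // => k _; rewrite mxE eqxx.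
have [k neq_k] : exists k, idx i k != idx j k.
  apply/existsP; apply: contraNT neq_ij => /existsPn eq_ij.
  by apply/eqP/enum_val_inj/ffunP => k; apply/eqP; have := eq_ij k; rewrite negbK.
by rewrite (bigD1 k) //= mxE (negPf neq_k) mul0r.
Qed.

Lemma tens_mxM A B : tens_mx (A *m B) = tens_mx A *m tens_mx B.
Proof.
apply/matrixP => i j; rewrite !mxE.
under [RHS]eq_bigr => l _ do rewrite !mxE -big_split /=.
rewrite (sum_tens_basis (fun f : {ffun 'I_n -> 'I_m} =>
  \prod_k (A (idx i k) (f k) * B (f k) (idx j k)))).
rewrite -(bigA_distr_bigA (fun k l => A (idx i k) l * B l (idx j k))).
by apply: eq_bigr => k _; rewrite mxE.
Qed.

Lemma pure_tensor_cyc a k :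
  pure_tensor a *m cyc_mx k = pure_tensor (fun l => a (cyc_shift k l)).
Proof.
have [s' sK s'K] := cyc_shift_bij k.
apply/rowP => j; rewrite !mxE.
under [LHS]eq_bigr => i _ do rewrite !mxE.
rewrite (sum_tens_basis (fun f : {ffun 'I_n -> 'I_m} => (\prod_l a l 0 (f l)) *
  (idx j == [ffun l => f (cyc_shift k l)])%:R)).
rewrite (bigD1 [ffun l => idx j (s' l)]) //= [X in _ + X]big1 => [|f neq_f]; last first.
  case: (idx j =P [ffun l => f (cyc_shift k l)]) => [def_j|_]; last by rewrite mulr0.
  by case/eqP: neq_f; apply/ffunP => l; rewrite ffunE def_j ffunE s'K.
rewrite addr0; have -> : [ffun l => [ffun l => idx j (s' l)] (cyc_shift k l)] = idx j.
  by apply/ffunP => l; rewrite !ffunE sK.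
rewrite eqxx mulr1.
rewrite (reindex _ (onW_bij _ (cyc_shift_bij k))) /=.
by apply: eq_bigr => l _; rewrite ffunE sK.
Qed.

Lemma tens_mx_cyc A k : tens_mx A *m cyc_mx k = cyc_mx k *m tens_mx A.
Proof.
have row_tens B i : row i (tens_mx B) = pure_tensor (fun l => row (idx i l) B).
  by apply/rowP => j; rewrite !mxE; apply: eq_bigr => l _; rewrite mxE.
have row_cyc i : row i (cyc_mx k) =
    pure_tensor (fun l => row (idx i (cyc_shift k l)) 1%:M).
  by rewrite rowE -row1 -tens_mx1 row_tens pure_tensor_cyc.
apply/row_matrixP => i; rewrite !row_mul row_tens pure_tensor_cyc row_cyc.
rewrite pure_tensorM; apply/rowP => j; rewrite !mxE.
by apply: eq_bigr => l _; rewrite -row_mul mul1mx.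
Qed.

(* The row space is the span of all z^k v - k.v; k ranges over Z/nZ.          *)
Definition cyc_rel (z : F) : 'M[F]_tens_dim :=
  (\sum_(k < n) ((z ^+ k)%:M - cyc_mx k))%MS.

Variables (gT : finGroupType) (G : {group gT}) (rG : mx_representation F G m).

Fact tens_mx_repr : mx_repr G (fun g => tens_mx (rG g)).
Proof.
by split=> [|g h Gg Gh]; rewrite ?repr_mx1 ?tens_mx1 // repr_mxM // tens_mxM.
Qed.

Definition tens_repr : mx_representation F G tens_dim :=
  MxRepresentation tens_mx_repr.

Fact cyc_rel_module z : mxmodule tens_repr (cyc_rel z).
Proof.
apply: sumsmx_module => k _; apply/mxmoduleP => g _ /=.
by rewrite mulmxBl -scalar_mxC -tens_mx_cyc -mulmxBr submxMl.
Qed.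

(* The representation induced on the quotient of the tensor power by cyc_rel. *)
Definition cyc_tens_repr (z : F) :
    mx_representation F G (\rank (cokermx (cyc_rel z))) :=
  factmod_repr (cyc_rel_module z).

End TensorPower.

Section ClassFunctions.

Variables (C : numClosedFieldType) (gT : finGroupType) (G : {group gT}).

(* Functions on G, with pointwise operations; subg_of G is G as a type.       *)
Definition gfun := {ffun subg_of G -> C^o}.

Definition char_of (m : nat) (rG : mx_representation C G m) : gfun :=
  [ffun g => \tr (rG (sgval g))].

Definition char_dot (f h : gfun) : C :=
  #|G|%:R^-1 * \sum_g f g * (h g : C)^*.

(* The logarithm of a power series over R(G); evaluation at g is a morphism   *)
(* of rings.                                                                  *)
Definition gfun_log (Q : nat -> gfun) : nat -> gfun :=
  fun k => [ffun g => ps_log (fun j => Q j g : C) k].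

(* The polynomial det (I - rho z^n) at g, as a power series.                  *)
Definition det_series (m : nat) (rG : mx_representation C G m) (n : nat) :
    nat -> gfun :=
  fun k => [ffun g =>
    (\det (1%:M - 'X^n *: map_mx polyC (rG (sgval g))))`_k].

(* For C algebraically closed of characteristic 0, irr_repr i for i : sG runs *)
(* over representatives of the isomorphism classes of irreducible             *)
(* representations of G, without repetition.                                  *)
Variable sG : irrType C G.

Definition in_RG (f : gfun) : Prop :=
  exists c : sG -> C, f = \sum_i c i *: char_of (irr_repr i).

Definition in_RGZ (f : gfun) : Prop :=
  exists c : sG -> int, f = \sum_i (c i)%:~R *: char_of (irr_repr i).

End ClassFunctions.

(* Main.v *)
Require Import Defs.
From mathcomp Require Import all_boot all_order all_algebra all_fingroup.
From mathcomp Require Import all_field mxrepresentation reals complex.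
From mathcomp Require Import boolp cyclic pgroup.
From mathcomp Require character.
Set Implicit Arguments.
Unset Strict Implicit.
Unset Printing Implicit Defensive.
Import GRing.Theory Num.Theory.
Local Open Scope ring_scope.

(** The argument works for any finite group G over an algebraically closed
field C of characteristic 0 with a complex conjugation.  Write chi_j for the
irreducible characters.

Diagonalising each rho(g) and using that the Mercator logarithm turns products
into sums, the coefficient of z^k in - log det (I - rho z^n) is
tr rho (g^(k/n)) / (k/n) if n divides k, and 0 otherwise ([log_det_char]).  So
the hypothesis on b says that the k-th coefficient of log Q is
[adams_sum b k g].  Its term for n = k is the class function
sum_i b_(k,i) chi_i, so that linear independence of the chi_i determines b by
induction on k ([adams_sum_inj]).

The recursion for r says that log Q = - sum_(n,j) r_(n,j) log (1 - chi_j z^n),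
where log (1 - chi_j z^n) is taken pointwise ([power_sum_recursion]).  Part (i)
is thus a comparison of the two kinds of Euler factors, 1 - chi_j(g) z and
det (I - rho(g) z).  It reduces to
  chi(g)^n = sum_(e | n) e * (character of the e-th cyclic power)(g^(n/e)),
which is [char_pow_cyc], and which has a combinatorial proof.  If a_1, ..., a_m
are the eigenvalues of rho(g), then chi(g)^n is the sum over all words w of
length n in the alphabet {1, ..., m} of the products of the a_(w l).  Each word
is in a unique way a power of a primitive word, whose length e divides n
([sum_words]).  On the other side, projecting the tensor power on the
zeta-eigenspace of the cyclic shift kills all words that are not primitive,
because the sum of a nontrivial character of their stabiliser vanishes
([sum_root_stabilizer]); so e times the cyclic character is the sum over the
primitive words of length e ([char_of_cyc_tens]).

For part (ii) it is enough, by (i), to find integral r, because multiplicities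
are natural numbers.  The logarithms of series over R(G, Z) with constant term
1 form a group that contains all the log (1 - chi_j z^n), and the first nonzero
coefficient of a member of it lies in R(G, Z) ([int_log_lead]).  So the r_(n,j)
can be peeled off one n at a time ([int_log_expansion]). *)

(** * Formal power series and their logarithms *)

Section PowerSeriesAlgebra.
Variable F : fieldType.
Implicit Types (f g h l : nat -> F) (p q : {poly F}).

(** Identities between power series are proved on truncations, in the ring of
polynomials. *)
Definition ps_trunc N f : {poly F} := \poly_(i < N) f i.
Definition ps_deriv f : nat -> F := fun n => f n.+1 *+ n.+1.

Lemma coef_ps_trunc N f n : (n < N)%N -> (ps_trunc N f)`_n = f n.
Proof. by move=> ltnN; rewrite coef_poly ltnN. Qed.

Lemma eq_coefM p p' q q' n :
    (forall i, (i <= n)%N -> p`_i = p'`_i) ->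
    (forall i, (i <= n)%N -> q`_i = q'`_i) ->
  (p * q)`_n = (p' * q')`_n.
Proof.
move=> eqp eqq; rewrite !coefM; apply: eq_bigr => i _.
by rewrite eqp ?eqq ?leq_subr // -ltnS.
Qed.

Lemma coefM_trunc N f g n :
  (n < N)%N -> (ps_trunc N f * ps_trunc N g)`_n = ps_mul f g n.
Proof.
move=> ltnN; rewrite coefM; apply: eq_bigr => -[i /= lein] _.
by rewrite !coef_ps_trunc // (leq_ltn_trans _ ltnN) ?leq_subr // -ltnS.
Qed.

Lemma coefX_trunc N f k n :
  (n < N)%N -> (ps_trunc N f ^+ k)`_n = ps_exp f k n.
Proof.
elim: k n => [|k IHk] n ltnN; first by rewrite expr0 coef1.
rewrite exprS /ps_exp iterS -/(ps_exp f k) -(coefM_trunc _ _ ltnN).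
apply: eq_coefM => // i lein; have ltiN := leq_ltn_trans lein ltnN.
by rewrite IHk ?coef_ps_trunc.
Qed.

Lemma ps_mulC f g n : ps_mul f g n = ps_mul g f n.
Proof. by rewrite -!(coefM_trunc _ _ (ltnSn n)) mulrC. Qed.

Lemma ps_mulA f g h n : ps_mul f (ps_mul g h) n = ps_mul (ps_mul f g) h n.
Proof.
rewrite -!(coefM_trunc _ _ (ltnSn n)).
pose t := ps_trunc n.+1; transitivity ((t f * t g * t h)`_n); rewrite -?mulrA.
  by apply: eq_coefM => // i lein; rewrite coefM_trunc ?coef_ps_trunc.
rewrite mulrA; apply: eq_coefM => // i lein.
by rewrite coefM_trunc ?coef_ps_trunc.
Qed.

Lemma eq_ps_mul f f' g g' : f =1 f' -> g =1 g' -> ps_mul f g =1 ps_mul f' g'.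
Proof. by move=> eqf eqg n; apply: eq_bigr => i _; rewrite eqf eqg. Qed.

Lemma ps_derivM f g n :
  ps_deriv (ps_mul f g) n = ps_mul (ps_deriv f) g n + ps_mul f (ps_deriv g) n.
Proof.
rewrite /ps_deriv -(coefM_trunc f g (ltnSn n.+1)) -coef_deriv derivM coefD.
have ltSn i : (i <= n)%N -> (i < n.+2)%N by move/leqW; rewrite ltnS.
congr (_ + _); rewrite -(coefM_trunc _ _ (ltnSn n)).
all: by apply: eq_coefM => i lein; rewrite ?coef_deriv !coef_ps_trunc // ltSn.
Qed.

(** A series with constant term 1 is invertible, hence can be cancelled. *)
Lemma ps_mul_inj f g h : f 0%N = 1 -> ps_mul f g =1 ps_mul f h -> g =1 h.
Proof.
move=> f0 eq_fgh n; elim/ltn_ind: n => n IHn; have := eq_fgh n.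
rewrite /ps_mul !big_ord_recl /= subn0 f0 !mul1r.
set s := \sum_i _; set s' := \sum_i _; have -> : s = s'; last exact: addIr.
by apply: eq_bigr => i _; rewrite IHn // ltn_subrL (leq_ltn_trans _ (ltn_ord i)).
Qed.

End PowerSeriesAlgebra.

Section LogDerivative.
Variable F : numFieldType.
Implicit Types (f g l : nat -> F).

(** The logarithmic derivative: f * (log f)' = f'.  Modulo z^(n+2), with U = f - 1,
the derivative of the Mercator polynomial is U' times a geometric sum in - U,
so multiplying it by 1 + U gives U' * (1 - (- U)^(n+1)). *)
Lemma ps_log_deriv f :
  f 0%N = 1 -> ps_mul f (ps_deriv (ps_log f)) =1 ps_deriv f.
Proof.
move=> f0 n; pose u j := f j - ps_one F j.
have u0 : u 0%N = 0 by rewrite /u f0 subrr.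
pose U := ps_trunc n.+2 u.
pose L := \sum_(1 <= k < n.+2) ((-1) ^+ k.-1 / k%:R) *: U ^+ k.
have coefL i : (i < n.+2)%N -> L`_i = ps_log f i.
  move=> lti; rewrite coef_sum /ps_log [LHS](big_cat_nat (n := i.+1)) //=.
  rewrite [X in _ + X]big_nat_cond [X in _ + X]big1 ?addr0; last first.
    move=> k /andP[/andP[ltik _] _].
    by rewrite coefZ coefX_trunc // ps_exp_val ?mulr0.
  by apply: eq_big_nat => k _; rewrite coefZ coefX_trunc.
have dL : L^`() = U^`() * \sum_(k < n.+1) (- U) ^+ k.
  rewrite /L big_add1 /= big_mkord raddf_sum mulr_sumr; apply: eq_bigr => k _.
  rewrite /= derivZ deriv_exp /= -scaler_nat scalerA divfK ?pnatr_eq0 //.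
  by rewrite -mul_polyC polyC_exp polyCN [(- U) ^+ k]exprNn mulrCA.
(* A geometric sum of ratio - U, because 1 + U = 1 - (- U). *)
have geoU : (1 + U) * \sum_(k < n.+1) (- U) ^+ k = 1 - (- U) ^+ n.+1.
  by rewrite -[RHS]opprB subrX1 -mulNr opprB opprK.
have eqf i : (i < n.+2)%N -> (1 + U)`_i = f i.
  by move=> lti; rewrite coefD coef1 coef_ps_trunc // addrC subrK.
transitivity (((1 + U) * L^`())`_n).
  rewrite -(coefM_trunc _ _ (ltnSn n)); apply: eq_coefM => i lein.
    by rewrite coef_ps_trunc // eqf // ltnS leqW.
  by rewrite coef_ps_trunc // coef_deriv coefL.
rewrite dL mulrCA geoU mulrBr mulr1 coefB coef_deriv coef_ps_trunc //.
rewrite {1}/u subr0 coefM big1 ?subr0 // => i _.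
rewrite exprNn -signr_odd; have ltni : (n - i < n.+1)%N by rewrite ltnS leq_subr.
(* U has no constant term, so the correction U^(n+1) does not reach degree n. *)
have Un : (U ^+ n.+1)`_(n - i) = 0.
  by rewrite coefX_trunc ?ps_exp_val // (leq_trans ltni).
by case: odd; rewrite ?expr1 ?expr0 ?mul1r ?mulN1r ?coefN Un ?oppr0 mulr0.
Qed.

(** In characteristic 0 the equation f * l' = f' has only one solution with
l(0) = 0.  All logarithms below are computed with this criterion rather than
from the Mercator series. *)
Lemma ps_log_unique f l :
  f 0%N = 1 -> l 0%N = 0 -> ps_mul f (ps_deriv l) =1 ps_deriv f -> l =1 ps_log f.
Proof.
move=> f0 l0 fdl [|n]; first by rewrite l0 /ps_log big_geq.
have /(_ n) : ps_deriv l =1 ps_deriv (ps_log f).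
  by apply: (ps_mul_inj f0) => i; rewrite fdl ps_log_deriv.
by rewrite /ps_deriv => /eqP; rewrite eqrMn2r /= => /eqP.
Qed.

Lemma eq_ps_log f g : f 0%N = 1 -> f =1 g -> ps_log f =1 ps_log g.
Proof.
move=> f0 eqfg; apply: ps_log_unique.
- by rewrite -eqfg.
- by rewrite /ps_log big_geq.
move=> n; rewrite -(eq_ps_mul eqfg (frefl _)) ps_log_deriv //.
by rewrite /ps_deriv eqfg.
Qed.

Lemma ps_logM f g n : f 0%N = 1 -> g 0%N = 1 ->
  ps_log (ps_mul f g) n = ps_log f n + ps_log g n.
Proof.
move=> f0 g0; apply/esym; move: n.
have fg0 : ps_mul f g 0 = 1 by rewrite /ps_mul big_ord1 f0 g0 mulr1.
apply: (ps_log_unique fg0) => [|n]; first by rewrite /ps_log !big_geq ?addr0.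
have -> : ps_deriv (fun k => ps_log f k + ps_log g k)
    = fun k => ps_deriv (ps_log f) k + ps_deriv (ps_log g) k.
  by apply/funext => k; rewrite /ps_deriv mulrnDl.
rewrite {1}/ps_mul; under eq_bigr => i _ do rewrite mulrDr.
rewrite big_split /= -![X in X + _]/(ps_mul _ _ n) -![X in _ + X]/(ps_mul _ _ n).
rewrite (eq_ps_mul (ps_mulC f g) (frefl _)) -!ps_mulA ps_derivM.
rewrite (eq_ps_mul (frefl _) (ps_log_deriv f0)) ps_mulC; congr (_ + _).
exact: eq_ps_mul (frefl _) (ps_log_deriv g0) _.
Qed.

Lemma ps_log1 : ps_log (ps_one F) =1 (fun=> 0).
Proof.
move=> n; apply/esym; move: n; apply: ps_log_unique => // n.
rewrite /ps_mul big1 => [|i _]; first by rewrite /ps_deriv /ps_one /= mul0rn.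
by rewrite /ps_deriv mul0rn mulr0.
Qed.

Lemma coef0_binom m (a : F) : (0 < m)%N -> (1 - a *: 'X^m)`_0 = 1.
Proof.
by move=> m_gt0; rewrite coefB coef1 coefZ coefXn (ltn_eqF m_gt0) mulr0 subr0.
Qed.

Lemma ps_mul_binom m a g n : ps_mul (fun k => (1 - a *: 'X^m)`_k) g n =
  g n - a * (if (m <= n)%N then g (n - m)%N else 0).
Proof.
transitivity (((1 - a *: 'X^m) * ps_trunc n.+1 g)`_n).
  rewrite -(coefM_trunc _ _ (ltnSn n)); apply: eq_coefM => // i lein.
  by rewrite coef_ps_trunc.
rewrite mulrBl mul1r coefB -scalerAl coefZ coefXnM coef_ps_trunc //.
by case: ltnP => // lemn; rewrite coef_ps_trunc // ltnS leq_subr.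
Qed.

(** The series 1 / (1 - a z^m). *)
Definition ps_geom a m : nat -> F :=
  fun k => if (m %| k)%N then a ^+ (k %/ m) else 0.

(** The series - log (1 - a z^m); its constant term is 0 because 0^-1 = 0. *)
Definition log_geom a m : nat -> F :=
  fun k => if (m %| k)%N then a ^+ (k %/ m) / (k %/ m)%:R else 0.

Lemma ps_log_binom m a : (0 < m)%N ->
  ps_log (fun k => (1 - a *: 'X^m)`_k) =1 (fun k => - log_geom a m k).
Proof.
move=> m_gt0 n; apply/esym; move: n.
apply: ps_log_unique => [||n]; first exact: coef0_binom.
  by rewrite /log_geom dvdn0 div0n invr0 mulr0 oppr0.
have dl k : ps_deriv (fun k => - log_geom a m k) k =
    - (if (m %| k.+1)%N then a ^+ (k.+1 %/ m) *+ m else 0).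
  rewrite /ps_deriv /log_geom mulNrn; case: ifP; last by rewrite mul0rn.
  case/dvdnP=> q def_k.
  rewrite def_k mulnK // mulrnA -[_ *+ q]mulr_natr divfK // pnatr_eq0.
  by case: q def_k.
rewrite ps_mul_binom !dl [RHS]/ps_deriv coefB coef1 coefZ coefXn sub0r.
case: leqP => [lemn | ltnm]; last first.
  rewrite mulr0 subr0 //; have [def_m | neq_m] := eqVneq n.+1 m.
    by rewrite def_m dvdnn divnn m_gt0 expr1 mulr1 mulNrn.
  rewrite gtnNdvd ?oppr0 ?mulr0 ?oppr0 ?mul0rn //.
  by rewrite ltn_neqAle neq_m.
rewrite gtn_eqF ?ltnS // mulr0 oppr0 mul0rn -subSn // dvdn_subl ?leqW //.
case: ifP => [/dvdnP[[|q] def_n] //|]; last by rewrite oppr0 mulr0 subr0.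
rewrite def_n mulSn addKn -mulSn !mulnK // mulrN mulrnAr -exprS opprK.
by rewrite addNr.
Qed.

Lemma ps_log_geom m a : (0 < m)%N -> ps_log (ps_geom a m) =1 log_geom a m.
Proof.
move=> m_gt0 n; have g0 : ps_geom a m 0 = 1 by rewrite /ps_geom dvdn0 div0n expr0.
have: ps_log (ps_mul (fun k => (1 - a *: 'X^m)`_k) (ps_geom a m)) n = 0.
  rewrite -[RHS](ps_log1 n); apply: eq_ps_log => [|k].
    by rewrite /ps_mul big_ord1 g0 mulr1 coef0_binom.
  rewrite ps_mul_binom /ps_geom /ps_one; case: leqP => [lemk | ltkm]; last first.
    rewrite mulr0 subr0; have [-> | k_gt0] := posnP k; first by rewrite dvdn0 div0n.
    by rewrite gtnNdvd // gtn_eqF.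
  rewrite dvdn_subl // gtn_eqF ?(leq_trans m_gt0) //.
  case: ifP => [/dvdnP[q def_k]|]; last by rewrite mulr0 subr0.
  case: q def_k => [|q] def_k; first by move: lemk; rewrite def_k leqNgt m_gt0.
  by rewrite def_k mulSn addKn -mulSn !mulnK // -exprS subrr.
rewrite ps_logM ?coef0_binom // ps_log_binom // => /eqP.
by rewrite addrC subr_eq0 => /eqP.
Qed.

Lemma ps_log_prod (I : finType) (p : I -> {poly F}) n :
    (forall i, (p i)`_0 = 1) ->
  ps_log (fun k => (\prod_i p i)`_k) n = \sum_i ps_log (fun k => (p i)`_k) n.
Proof.
move=> p0; set P := \prod_i p i; have [] : P`_0 = 1 /\
    ps_log (fun k => P`_k) n = \sum_i ps_log (fun k => (p i)`_k) n; last by [].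
rewrite /P; elim/big_rec2: _ => [|i s q _ [q0 <-]].
  split; first by rewrite coef1.
  rewrite -[RHS](ps_log1 n); apply: eq_ps_log; first by rewrite coef1.
  by move=> k; rewrite coef1.
have eqM k : (p i * q)`_k = ps_mul (fun k => (p i)`_k) (fun k => q`_k) k.
  by rewrite coefM.
split; first by rewrite eqM /ps_mul big_ord1 p0 q0 mulr1.
rewrite -ps_logM //; apply: eq_ps_log => //.
by rewrite eqM /ps_mul big_ord1 p0 q0 mulr1.
Qed.

End LogDerivative.

(** * Eigenvalues, characters and orthogonality *)

Section Spectrum.
Variable C : numClosedFieldType.

Lemma prim_root_exists n : (0 < n)%N -> exists z : C, n.-primitive_root z.
Proof.
move=> n_gt0; pose p : {poly C} := 'X^n - 1.
have [r Dp] := closed_field_poly_normal p.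
rewrite (monicP _) ?monicXnsubC // scale1r in Dp.
have rn1 : all n.-unity_root r by apply/allP=> z; rewrite -root_prod_XsubC -Dp.
have sz_r : (n < (size r).+1)%N.
  by rewrite -(size_prod_XsubC r id) -Dp size_XnsubC.
have [|z] := hasP (has_prim_root n_gt0 rn1 _ sz_r); last by exists z.
by rewrite -separable_prod_XsubC -Dp separable_Xn_sub_1 // pnatr_eq0 -lt0n.
Qed.

Variables (gT : finGroupType) (G : {group gT}).

(** The matrix of g is annihilated by X^#|G| - 1, which splits with simple roots.
The same basis diagonalises all the powers of g. *)
Lemma repr_diag n (rG : mx_representation C G n) g : g \in G ->
  exists B (a : 'I_n -> C), [/\ B \in unitmx, forall i, a i ^+ #|G| = 1 &
    forall k, rG (g ^+ k)%g = invmx B *m diag_mx (\row_i a i ^+ k) *m B].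
Proof.
case: n rG => [|n] rG Gg.
  exists 1%:M, (fun=> 0); split=> [|[]//|k]; first exact: unitmx1.
  by rewrite [LHS]flatmx0 [RHS]flatmx0.
have [z prim_z] := prim_root_exists (cardG_gt0 G).
have [|P uP dP] := (diagonalizableP (rG g)).2.
  (* The #|G|-th roots of unity contain all eigenvalues. *)
  exists [seq z ^+ i | i <- index_iota 0 #|G|].
    rewrite map_inj_in_uniq ?iota_uniq // => i j.
    rewrite !mem_index_iota /= => ltiG ltjG /eqP.
    by rewrite (eq_prim_root_expr prim_z) !modn_small // => /eqP.
  apply: mxminpoly_min; rewrite big_map (factor_Xn_sub_1 prim_z).
  rewrite rmorphB rmorphXn /= horner_mx_X rmorph1.
  by rewrite -repr_mxX // expg_cardG // repr_mx1 subrr.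
have [e rGe] := diagonalizable_forLR uP dP; exists P, (e 0).
have rGX k : rG (g ^+ k)%g = invmx P *m diag_mx (\row_i e 0 i ^+ k) *m P.
  elim: k => [|k IHk].
    rewrite repr_mx1 (_ : \row_i _ = const_mx 1) ?diag_const_mx ?mulmx1 ?mulVmx //.
    by apply/rowP => i; rewrite !mxE.
  rewrite expgSr repr_mxM ?groupX // IHk rGe mxpoly.conjVmx // !mulmxA mulmxK //.
  rewrite -[_ *m diag_mx _ *m diag_mx _]mulmxA mulmx_diag.
  by congr (_ *m diag_mx _ *m _); apply/rowP => i; rewrite !mxE exprSr.
split=> // i; have := rGX #|G|; rewrite expg_cardG // repr_mx1.
move/(congr1 (fun M => P *m M *m invmx P)).
rewrite mulmx1 mulmxV // !mulmxA mulmxV // mul1mx mulmxK //.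
by move/matrixP/(_ i i); rewrite !mxE eqxx !mulr1n => <-.
Qed.

Section OneElement.
Variables (n : nat) (rG : mx_representation C G n) (g : subg_of G).
Variables (B : 'M[C]_n) (a : 'I_n -> C).
Hypothesis uB : B \in unitmx.
Hypothesis rGX :
  forall k, rG (sgval g ^+ k)%g = invmx B *m diag_mx (\row_i a i ^+ k) *m B.

Lemma char_of_diag k : char_of rG (g ^+ k)%g = \sum_i a i ^+ k.
Proof.
rewrite ffunE morphX ?inE // rGX mxtrace_mulC mulKVmx // mxtrace_diag.
by apply: eq_bigr => i _; rewrite mxE.
Qed.

Lemma det_series_diag d : (0 < d)%N ->
  gfun_log (det_series rG d) ^~ g =1
    (fun k => - \sum_i log_geom (a i) d k).
Proof.
move=> d_gt0 k; rewrite ffunE.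
have -> : (fun j => det_series rG d j g : C)
    = (fun j => (\prod_i (1 - a i *: 'X^d))`_j).
  apply/funext => j; rewrite ffunE; congr (_`_j).
  pose Bp := map_mx polyC B; have uBp : Bp \in unitmx by rewrite map_unitmx.
  have -> : 1%:M - 'X^d *: map_mx polyC (rG (sgval g)) =
      invmx Bp *m diag_mx (\row_i (1 - a i *: 'X^d)) *m Bp.
    rewrite -[sgval g]expg1 rGX !map_mxM map_invmx -/Bp map_diag_mx.
    rewrite -[1%:M in LHS](mulVmx uBp) -{2}[Bp]mul1mx mulmxA.
    rewrite scalemxAl scalemxAr -mulmxBl -mulmxBr.
    congr (_ *m _ *m _); apply/matrixP => i l; rewrite !mxE.
    case: eqP => [->|_]; last by rewrite !mulr0n mulr0 subr0.
    by rewrite !mulr1n expr1 mulrC mul_polyC.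
  rewrite !det_mulmx det_inv mulrAC mulVr -?unitmxE // mul1r det_diag.
  by under eq_bigr => i _ do rewrite mxE.
rewrite ps_log_prod => [|i]; last exact: coef0_binom.
by rewrite -sumrN; apply: eq_bigr => i _; rewrite ps_log_binom.
Qed.
End OneElement.

Lemma char_ofV n (rG : mx_representation C G n) (g : subg_of G) :
  char_of rG g^-1%g = (char_of rG g : C)^*.
Proof.
have Gg := subgP g; have [B [a [uB aG rGX]]] := repr_diag rG Gg.
have -> : (g^-1 = g ^+ #|G|.-1)%g.
  apply: (mulgI g); rewrite mulgV -expgS prednK //.
  by apply: val_inj; rewrite /= morphX ?inE // expg_cardG.
rewrite -[g in RHS]expg1 !(char_of_diag uB rGX) rmorph_sum.
apply: eq_bigr => i _; have a_unit : a i \is a GRing.unit.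
  by rewrite -(unitrX_pos _ (cardG_gt0 G)) aG unitr1.
apply: (mulrI a_unit); rewrite -exprS prednK // aG expr1 -normCK.
have -> : `|a i| = 1; last by rewrite expr1n.
by apply/eqP; rewrite -(@pexpr_eq1 _ _ #|G|) // -normrX aG normr1.
Qed.

Lemma log_det_char n (rG : mx_representation C G n) d k (g : subg_of G) :
  (0 < d)%N -> (0 < k)%N -> gfun_log (det_series rG d) k g =
    if (d %| k)%N then - (char_of rG (g ^+ (k %/ d))%g / (k %/ d)%:R) else 0.
Proof.
move=> d_gt0 k_gt0; have [B [a [uB aG rGX]]] := repr_diag rG (subgP g).
rewrite (det_series_diag uB rGX) // /log_geom.
case: ifP => _; last by rewrite big1 ?oppr0.
by rewrite (char_of_diag uB rGX) -mulr_suml.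
Qed.

Lemma char_of_tens n (rG : mx_representation C G n) d (g : subg_of G) :
  char_of (tens_repr d rG) g = (char_of rG g : C) ^+ d.
Proof.
rewrite !ffunE /mxtrace; under eq_bigr => i _ do rewrite mxE.
rewrite (sum_tens_basis (fun f : {ffun 'I_d -> 'I_n} =>
  \prod_k rG (sgval g) (f k) (f k))).
rewrite -(bigA_distr_bigA (fun _ l => rG (sgval g) l l)).
by rewrite prodr_const card_ord.
Qed.

End Spectrum.

Section Irreducible.
Variables (C : numClosedFieldType) (gT : finGroupType) (G : {group gT}).
Variable sG : irrType C G.
Local Notation chi i := (char_of (irr_repr (i : sG))).

Let C'G : ([pchar C]^'.-group G)%g.
Proof. by apply: sub_pgroup (pgroup_pi G) => p _; rewrite inE /= pchar_num. Qed.

Let splitG : group_splitting_field C G.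
Proof. exact: group_closure_closed_field. Qed.

(** Maschke's theorem: the representation is the direct sum of its isotypic
components. *)
Lemma char_of_irr_sum n (rG : mx_representation C G n) :
  exists m : sG -> nat, char_of rG = \sum_i (m i)%:R *: chi i.
Proof.
pose sR := DecSocleType rG.
exists (fun i => \sum_(W : sR | irr_comp sG (socle_repr W) == i) socle_mult W)%N.
apply/ffunP => g; rewrite sum_ffunE ffunE.
have soc1 : (Socle sR :=: 1%:M)%MS.
  by rewrite (reducible_Socle1 sR (mx_Maschke_pchar rG C'G)).
rewrite -(mxtrace_submod1 (Socle_module sR) soc1) ?subgP // mxtrace_Socle ?subgP //.
rewrite (partition_big (fun W : sR => irr_comp sG (socle_repr W)) predT) //=.
apply: eq_bigr => i _; rewrite !ffunE natr_sum scaler_suml.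
apply: eq_bigr => W /eqP <-; rewrite scaler_nat; congr (_ *+ _).
by rewrite (mxtrace_rsim (rsim_irr_comp_pchar sG C'G (socle_irr W))) ?subgP.
Qed.


Lemma sum_subg (T : nmodType) (h : gT -> T) :
  \sum_(g : subg_of G) h (sgval g) = \sum_(x in G) h x.
Proof.
rewrite [RHS](reindex_onto (@sgval gT G) (subg G)) => [|x Gx]; last exact: subgK.
by apply: eq_bigl => g; rewrite subgP sgvalK eqxx.
Qed.

Local Notation aG := (regular_repr C G).
Local Notation op i := (gring_op (irr_repr (i : sG))).
Local Notation eid i := (Wedderburn_id (i : sG)).

(** The central idempotents of the group algebra act as 0 or 1 on each
irreducible representation; orthogonality of characters comes from this. *)
Lemma op_Wedderburn_id_eq i j : op j (eid i) = (i == j)%:R%:M.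
Proof.
case: eqVneq => [->|neq_ij]; first exact: op_Wedderburn_id_pchar.
rewrite (irr_repr'_op0_pchar C'G neq_ij (Wedderburn_id_mem i)).
by rewrite -scalemx1 scale0r.
Qed.

(** The coefficients of the central idempotent e_i on the basis G are read off the
regular character, which is #|G| at 1 and 0 elsewhere: that of y is
n_i chi_i(y^-1) / #|G|.  The trace of e_i in the j-th irreducible representation
then is, up to the factor n_i, the inner product of chi_j and chi_i. *)
Lemma irr_orthonormal i j : char_dot (chi j) (chi i) = (i == j)%:R.
Proof.
have G0 : #|G|%:R != 0 :> C by rewrite pnatr_eq0 -lt0n cardG_gt0.
have n0 k : (irr_degree (k : sG))%:R != 0 :> C.
  by rewrite pnatr_eq0 -lt0n irr_degree_gt0.
have /envelop_mxP[c def_e] : ((eid i) \in group_ring C G)%MS.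
  move: (Wedderburn_id_mem i); rewrite genmxE mem_sub_gring.
  by case/andP.
have op_sum k : op k (eid i) = \sum_(x in G) c x *: irr_repr k x.
  rewrite {1}def_e linear_sum; apply: eq_bigr => x Gx.
  by rewrite linearZ /= gring_opG.
have tr_reg x : x \in G -> \tr (aG x) = #|G|%:R *+ (x == 1%g).
  move=> Gx; have [-> | ntx] := eqVneq x 1%g; first by rewrite repr_mx1 mxtrace1.
  rewrite [\tr _]big1 // => k _; rewrite 2!mxE /=.
  rewrite -(inj_eq enum_val_inj) gring_indexK ?groupM ?enum_valP //.
  by rewrite eq_mulVg1 mulKg (negbTE ntx).
have c_eq y : y \in G ->
    c y = #|G|%:R^-1 * (irr_degree i)%:R * \tr (irr_repr i y^-1%g).
  move=> Gy; apply: (mulfI G0); rewrite !mulrA divff // mul1r.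
  (* Both sides are the trace of e_i y^-1 in the regular representation. *)
  transitivity (\sum_(x in G) c x * \tr (aG (x * y^-1)%g)).
    rewrite (bigD1 y) //= mulgV tr_reg // eqxx mulrC big1 ?addr0 //.
    move=> x /andP[Gx neq_xy]; rewrite tr_reg ?groupM ?groupV //.
    by rewrite -eq_mulgV1 (negPf neq_xy) mulr0.
  under eq_bigr => x Gx do
    rewrite (mxtrace_regular_pchar sG C'G splitG) ?groupM ?groupV // mulr_sumr.
  rewrite exchange_big (bigD1 i) //= [X in _ + X]big1 => [|k neq_ki].
    have op1 : op i (eid i) = 1%:M by rewrite op_Wedderburn_id_eq eqxx.
    rewrite addr0 -[in RHS](mul1mx (irr_repr i _)) -op1 op_sum.
    rewrite mulmx_suml !raddf_sum mulr_sumr /=; apply: eq_bigr => x Gx.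
    rewrite -scalemxAl -repr_mxM ?groupV // linearZ /=.
    by rewrite -[X in _ * X = _]mulr_natl mulrCA.
  transitivity ((irr_degree k)%:R * \tr (op k (eid i) *m irr_repr k y^-1%g)).
    rewrite op_sum mulmx_suml !raddf_sum mulr_sumr /=; apply: eq_bigr => x Gx.
    rewrite -scalemxAl -repr_mxM ?groupV // linearZ /=.
    by rewrite -[X in _ * X = _]mulr_natl mulrCA.
  by rewrite op_Wedderburn_id_eq eq_sym (negPf neq_ki) mul_scalar_mx
    scale0r mxtrace0 mulr0.
have: \tr (op j (eid i)) = (irr_degree i)%:R * char_dot (chi j) (chi i).
  rewrite op_sum raddf_sum /= /char_dot mulrCA; rewrite mulr_sumr.
  rewrite -(sum_subg (fun x => \tr (c x *: irr_repr j x))) mulr_sumr.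
  apply: eq_bigr => g _; rewrite linearZ /= c_eq ?subgP // -char_ofV !ffunE.
  by rewrite -!mulrA; congr (_ * _); congr (_ * _); rewrite mulrC.
rewrite op_Wedderburn_id_eq mxtrace_scalar; case: eqVneq => [->|_].
  by move=> def_n; apply: (mulfI (n0 j)); rewrite mulr1 -def_n.
by rewrite mul0rn => /esym/eqP; rewrite mulf_eq0 (negPf (n0 _)) => /eqP.
Qed.

Lemma char_dot_irr_sum (c : sG -> C) i :
  char_dot (\sum_j c j *: chi j) (chi i) = c i.
Proof.
transitivity (\sum_j c j * char_dot (chi j) (chi i)).
  rewrite /char_dot; under [RHS]eq_bigr => j _ do rewrite mulrCA mulr_sumr.
  rewrite -mulr_sumr exchange_big; congr (_ * _); apply: eq_bigr => g _ /=.
  rewrite sum_ffunE mulr_suml; apply: eq_bigr => j _.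
  by rewrite !ffunE mulrA.
rewrite (bigD1 i) //= irr_orthonormal eqxx mulr1 big1 ?addr0 // => j neq_ji.
by rewrite irr_orthonormal eq_sym (negPf neq_ji) mulr0.
Qed.

Lemma irr_free (c c' : sG -> C) :
  \sum_i c i *: chi i = \sum_i c' i *: chi i -> c =1 c'.
Proof. by move=> eqc i; rewrite -(char_dot_irr_sum c i) eqc char_dot_irr_sum. Qed.

Lemma char_dot_nat n (rG : mx_representation C G n) i :
  exists m : nat, char_dot (char_of rG) (chi i) = m%:R.
Proof.
by have [m ->] := char_of_irr_sum rG; exists (m i); rewrite char_dot_irr_sum.
Qed.

Lemma char_of_dot n (rG : mx_representation C G n) :
  char_of rG = \sum_i char_dot (char_of rG) (chi i) *: chi i.
Proof.
have [m ->] := char_of_irr_sum rG.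
by apply: eq_bigr => i _; rewrite char_dot_irr_sum.
Qed.

Lemma gfunZE (c : C) (f : gfun C G) g : (c *: f) g = c * f g.
Proof. by rewrite ffunE. Qed.

Lemma in_RGZ_char n (rG : mx_representation C G n) : in_RGZ sG (char_of rG).
Proof. by have [m ->] := char_of_irr_sum rG; exists (fun i => (m i)%:Z). Qed.

Lemma in_RGZ0 : in_RGZ sG 0.
Proof. by exists (fun=> 0); rewrite big1 // => i _; rewrite scale0r. Qed.

Lemma in_RGZ_comb (I : finType) (c : I -> int) (f : I -> gfun C G) :
  (forall i, in_RGZ sG (f i)) -> in_RGZ sG (\sum_i (c i)%:~R *: f i).
Proof.
move=> /choice[d fE]; exists (fun k => \sum_i c i * d i k).
transitivity (\sum_i \sum_k (c i * d i k)%:~R *: chi k).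
  apply: eq_bigr => i _; rewrite fE scaler_sumr.
  by apply: eq_bigr => k _; rewrite scalerA intrM.
rewrite exchange_big; apply: eq_bigr => k _; rewrite /= -scaler_suml.
by rewrite rmorph_sum.
Qed.

Lemma in_RGZ_sum (I : finType) (f : I -> gfun C G) :
  (forall i, in_RGZ sG (f i)) -> in_RGZ sG (\sum_i f i).
Proof.
move=> fZ; have := in_RGZ_comb (fun=> 1) fZ.
by under eq_bigr => i _ do rewrite scale1r.
Qed.

(** Products of characters are characters of tensor products. *)
Lemma in_RGZM (f h : gfun C G) : in_RGZ sG f -> in_RGZ sG h -> in_RGZ sG (f * h).
Proof.
move=> [c ->] [d ->].
have -> : (\sum_i (c i)%:~R *: chi i) * (\sum_j (d j)%:~R *: chi j) =
    \sum_i (c i)%:~R *: \sum_j (d j)%:~R *: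
      char_of (character.prod_repr (irr_repr i) (irr_repr j)).
  apply/ffunP => g; rewrite ffunE !sum_ffunE mulr_suml; apply: eq_bigr => i _.
  rewrite !gfunZE sum_ffunE !mulr_sumr; apply: eq_bigr => j _.
  by rewrite !gfunZE [in RHS]ffunE /= character.mxtrace_prod mulrACA -mulrA !ffunE.
by do 2![apply: in_RGZ_comb => ?]; apply: in_RGZ_char.
Qed.

Lemma in_RGZ1 : in_RGZ sG 1.
Proof.
(* The tensor power of order 0 of any representation is trivial. *)
have -> : 1 = char_of (tens_repr 0 (regular_repr C G)) :> gfun C G.
  by apply/ffunP => g; rewrite char_of_tens expr0 ffunE.
exact: in_RGZ_char.
Qed.

Lemma in_RGZX (f : gfun C G) n : in_RGZ sG f -> in_RGZ sG (f ^+ n).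
Proof.
move=> fZ; elim: n => [|n IHn]; first exact: in_RGZ1.
by rewrite exprS; apply: in_RGZM.
Qed.

Lemma gfunXE (f : gfun C G) n g : (f ^+ n) g = (f g : C) ^+ n.
Proof. by elim: n => [|n IHn]; rewrite ?expr0 ?exprS ffunE ?IHn. Qed.

End Irreducible.

(** * Primitive words and cyclic tensor powers *)

Section Words.
Variable T : finType.
Implicit Types n e k m : nat.

(** A word of length n is a basis element of the n-th tensor power, and [rotw] is
the action of the cyclic shift on words. *)
Definition rotw n k (w : {ffun 'I_n -> T}) := [ffun l => w (cyc_shift k l)].

Definition primitive_word n (w : {ffun 'I_n -> T}) :=
  [forall m : 'I_n, (0 < m)%N ==> (rotw m w != w)].

Definition least_period n e (w : {ffun 'I_n -> T}) :=
  (rotw e w == w) && [forall m : 'I_e, (0 < m)%N ==> (rotw m w != w)].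

Section Rotation.
Variable n : nat.
Implicit Types w : {ffun 'I_n -> T}.

Lemma rotw_add j k w : rotw j (rotw k w) = rotw (j + k) w.
Proof. by apply/ffunP => l; rewrite !ffunE /cyc_shift addnC iterD. Qed.

Lemma rotw0 w : rotw 0 w = w.
Proof. by apply/ffunP => l; rewrite ffunE. Qed.

Lemma rotw_mod k w : rotw (k %% n) w = rotw k w.
Proof.
apply/ffunP => l; rewrite !ffunE; congr (w _).
by apply: val_inj; rewrite /= !cyc_shift_val modnDmr.
Qed.

Lemma rotw_mul k q w : rotw k w = w -> rotw (q * k) w = w.
Proof.
by move=> fix_w; elim: q => [|q IHq]; rewrite ?rotw0 // mulSn -rotw_add IHq.
Qed.

Lemma rotw_size w : rotw n w = w.
Proof. by rewrite -rotw_mod modnn rotw0. Qed.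

(** The rotations that fix w are the multiples of the least positive one. *)
Lemma period_exists w : (0 < n)%N ->
  exists2 p, (p %| n)%N & forall e, (0 < e)%N -> least_period e w = (e == p).
Proof.
move=> n_gt0; have ex_p : exists p, (0 < p)%N && (rotw p w == w).
  by exists n; rewrite n_gt0 rotw_size eqxx.
case: (ex_minnP ex_p) => p /andP[p_gt0 /eqP fix_w] min_p.
have period_p : [forall m : 'I_p, (0 < m)%N ==> (rotw m w != w)].
  apply/forallP => m; apply/implyP => m_gt0; apply/negP => fix_m.
  by have := min_p m; rewrite m_gt0 fix_m leqNgt ltn_ord => /(_ isT).
exists p => [|e e_gt0].
  rewrite /dvdn -leqn0 leqNgt; apply/negP => r_gt0.
  have fix_r : rotw (n %% p) w = w.
    transitivity (rotw (n %% p + n %/ p * p) w); first by rewrite -rotw_add rotw_mul.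
    by rewrite addnC -divn_eq rotw_size.
  have := min_p (n %% p)%N; rewrite r_gt0 fix_r eqxx leqNgt ltn_pmod //.
  by move/(_ isT).
apply/andP/eqP => [[fix_e /forallP min_e] | ->]; last by rewrite fix_w eqxx.
apply/eqP; rewrite eqn_leq min_p ?e_gt0 ?fix_e // andbT leqNgt.
apply/negP => ltpe; have := min_e (Ordinal ltpe).
by rewrite /= p_gt0 fix_w eqxx.
Qed.

End Rotation.

Section Unroll.
Variables (e n : nat).
Hypotheses (e_gt0 : (0 < e)%N) (e_n : (e %| n)%N) (n_gt0 : (0 < n)%N).

(** The power w^(n/e) of a word w of length e. *)
Definition unroll (w : {ffun 'I_e -> T}) : {ffun 'I_n -> T} :=
  [ffun l => w (Ordinal (ltn_pmod (val l) e_gt0))].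

Definition prefix_word (w : {ffun 'I_n -> T}) : {ffun 'I_e -> T} :=
  [ffun k => w (widen_ord (dvdn_leq n_gt0 e_n) k)].

Lemma unrollK : cancel unroll prefix_word.
Proof.
move=> w; apply/ffunP => k; rewrite !ffunE; congr (w _).
by apply: val_inj; rewrite /= modn_small.
Qed.

Lemma rotw_unroll k w : rotw k (unroll w) = unroll (rotw k w).
Proof.
apply/ffunP => l; rewrite !ffunE; congr (w _); apply: val_inj => /=.
by rewrite !cyc_shift_val modn_dvdm //= modnDml.
Qed.

Lemma least_period_unroll w : least_period e (unroll w) = primitive_word w.
Proof.
have fixE k : (rotw k (unroll w) == unroll w) = (rotw k w == w).
  by rewrite rotw_unroll (inj_eq (can_inj unrollK)).
rewrite /least_period fixE rotw_size eqxx /=.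
by apply: eq_forallb => m; rewrite fixE.
Qed.

Lemma prefix_wordK w : least_period e w -> unroll (prefix_word w) = w.
Proof.
case/andP => /eqP fix_w _; apply/ffunP => l; rewrite !ffunE.
rewrite -{1}(rotw_mul (l %/ e) fix_w) ffunE; congr (w _).
apply: val_inj; rewrite /= cyc_shift_val /= addnC -divn_eq.
by rewrite modn_small.
Qed.

Lemma prod_unroll (R : comPzSemiRingType) (x : T -> R) w :
  \prod_l x (unroll w l) = \prod_k x (w k) ^+ (n %/ e).
Proof.
pose F l := x (w (Ordinal (ltn_pmod l e_gt0))).
have FD l : F (l + e)%N = F l.
  by rewrite /F; congr (x (w _)); apply: val_inj; rewrite /= modnDr.
have prodF q : \prod_(0 <= l < q * e) F l = (\prod_(0 <= l < e) F l) ^+ q.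
  elim: q => [|q IHq]; first by rewrite big_geq.
  rewrite mulSn (big_cat_nat (n := e)) ?leq_addr //= exprS; congr (_ * _).
  rewrite -IHq -{1}[e]add0n big_addn addKn.
  by apply: eq_bigr => l _; rewrite FD.
transitivity (\prod_(0 <= l < n %/ e * e) F l).
  rewrite divnK // big_mkord; apply: eq_bigr => l _.
  by rewrite ffunE.
rewrite prodF big_mkord prodrXl; congr (_ ^+ _).
apply: eq_bigr => k _; rewrite /F; congr (x (w _)).
by apply: val_inj; rewrite /= modn_small.
Qed.

End Unroll.

(** Words of length n are grouped by the primitive word of which they are a
power. *)
Lemma sum_words (R : comPzSemiRingType) (x : T -> R) n : (0 < n)%N ->
  (\sum_t x t) ^+ n = \sum_(e <- divisors n)
    \sum_(w : {ffun 'I_e -> T} | primitive_word w) \prod_k x (w k) ^+ (n %/ e).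
Proof.
move=> n_gt0.
transitivity (\sum_(w : {ffun 'I_n -> T}) \prod_l x (w l)).
  rewrite -(bigA_distr_bigA (fun _ t => x t)) prodr_const card_ord.
  by [].
transitivity (\sum_(e <- divisors n)
    \sum_(w : {ffun 'I_n -> T} | least_period e w) \prod_l x (w l)).
  under [RHS]eq_bigr => e _ do rewrite big_mkcond.
  rewrite exchange_big; apply: eq_bigr => w _ /=.
  (* Each word has exactly one least period, so it occurs in one inner sum. *)
  have [p p_n period_w] := period_exists w n_gt0.
  rewrite (bigD1_seq p) ?divisors_uniq -?dvdn_divisors //=.
  rewrite period_w ?(dvdn_gt0 n_gt0) // eqxx [X in _ + X]big1_seq ?addr0 // => e.
  rewrite -dvdn_divisors // => /andP[neq_ep e_n].
  by rewrite period_w ?(dvdn_gt0 n_gt0) // (negPf neq_ep).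
apply: eq_big_seq => e; rewrite -dvdn_divisors // => e_n.
have e_gt0 := dvdn_gt0 n_gt0 e_n.
rewrite (reindex_onto (unroll n e_gt0) (prefix_word e_n n_gt0)) /=; last first.
  exact: prefix_wordK.
apply: eq_big => [w|w _]; last exact: prod_unroll.
by rewrite least_period_unroll // unrollK eqxx andbT.
Qed.

End Words.

Section CyclicPower.
Variable C : numClosedFieldType.

(** If a rotation by 0 < m < n fixes w, then translating the index by m multiplies
the sum by z^-m, which is not 1. *)
Lemma sum_root_stabilizer (T : finType) n (z : C) (w : {ffun 'I_n -> T}) :
    n.-primitive_root z ->
  \sum_(k < n) (z ^+ k)^-1 * (rotw k w == w)%:R = (primitive_word w)%:R.
Proof.
move=> prim_z; have n_gt0 := prim_order_gt0 prim_z.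
have [prim_w | nprim_w] := boolP (primitive_word w).
  rewrite (bigD1 (Ordinal n_gt0)) //= expr0 invr1 rotw0 eqxx mul1r.
  rewrite big1 ?addr0 // => k neq_k0; have := forallP prim_w k.
  rewrite lt0n -[k != 0%N :> nat]/(k != Ordinal n_gt0) neq_k0 /=.
  by move/negPf->; rewrite mulr0.
have /forallPn[m] := nprim_w; rewrite negb_imply negbK => /andP[m_gt0 /eqP fix_w].
(* The sum S is 0 because (1 - z^-m) S = 0 and z^-m != 1. *)
set S := \sum_k _; apply/eqP; rewrite -[S == 0]orFb.
have <- : (1 - (z ^+ m)^-1 == 0) = false.
  rewrite subr_eq0 eq_sym invr_eq1 -[1](expr0 z) (eq_prim_root_expr prim_z).
  by rewrite mod0n modn_small // gtn_eqF.
rewrite -mulf_eq0 mulrBl mul1r subr_eq0 /S; apply/eqP.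
rewrite [LHS](reindex _ (onW_bij _ (cyc_shift_bij n m))) mulr_sumr.
apply: eq_bigr => k _ /=; rewrite cyc_shift_val rotw_mod -rotw_add fix_w.
by rewrite (prim_expr_mod prim_z) exprD invfM mulrA; congr (_ * _); rewrite mulrC.
Qed.

(** The trace on a quotient by U is computed with any matrix P that vanishes on U
and is the identity modulo U.  Another such matrix is the composite K of the
projection to the quotient with its chosen section.  If A commutes with P, the
traces of A K = A P K = P A K and of A P = A K P agree. *)
Lemma mxtrace_factmod_proj (gT : finGroupType) (G : {group gT}) n
    (rG : mx_representation C G n) (U P : 'M_n) (modU : mxmodule rG U) g :
    U *m P = 0 -> (1%:M - P <= U)%MS -> rG g *m P = P *m rG g ->
  \tr (factmod_repr modU g) = \tr (rG g *m P).
Proof.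
move=> UP0 sPU comm_P; pose K := val_factmod (in_factmod U 1%:M).
have UK0 : U *m K = 0.
  apply/eqP; rewrite /K val_factmodE in_factmodE mulmxA mulmxA -in_factmodE.
  rewrite mulmx1 -val_factmodE val_factmod_eq0.
  by rewrite in_factmod_eq0.
have sKU : (1%:M - K <= U)%MS.
  by rewrite -{1}(add_sub_fact_mod U 1%:M) addrK val_submodP.
have [X defX] := submxP sPU; have [Y defY] := submxP sKU.
have PK : P *m K = K.
  apply/eqP; rewrite eq_sym -subr_eq0 -{1}[K]mul1mx -mulmxBl defX.
  by rewrite -mulmxA UK0 mulmx0.
have KP : K *m P = P.
  apply/eqP; rewrite eq_sym -subr_eq0 -{1}[P]mul1mx -mulmxBl defY.
  by rewrite -mulmxA UP0 mulmx0.
transitivity (\tr (rG g *m K)).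
  rewrite /= /factmod_mx in_factmodE mxtrace_mulC.
  rewrite val_factmodE mulmxA mxtrace_mulC /K val_factmodE.
  by rewrite !mul1mx -val_factmodE.
by rewrite -{1}PK mulmxA comm_P -mulmxA mxtrace_mulC -mulmxA KP comm_P.
Qed.

Variables (m n : nat).
Local Notation idx i := (enum_val i : {ffun 'I_n -> 'I_m}).
Local Notation cyc_mx k := (@cyc_mx C m n k).

Lemma cyc_mxE k i j : cyc_mx k i j = (idx j == rotw k (idx i))%:R.
Proof. by rewrite mxE. Qed.

Lemma cyc_mxM j k : cyc_mx j *m cyc_mx k = cyc_mx (j + k).
Proof.
apply/matrixP => i l; rewrite mxE.
under eq_bigr => x _ do rewrite !cyc_mxE.
rewrite (sum_tens_basis (fun w : {ffun 'I_n -> 'I_m} =>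
  (w == rotw j (idx i))%:R * (idx l == rotw k w)%:R)).
rewrite (bigD1 (rotw j (idx i))) //= eqxx mul1r big1 ?addr0 => [|w /negPf->].
  by rewrite rotw_add addnC cyc_mxE.
by rewrite mul0r.
Qed.

Lemma cyc_mx_mod k : cyc_mx (k %% n) = cyc_mx k.
Proof. by apply/matrixP => i j; rewrite !cyc_mxE rotw_mod. Qed.

Lemma tens_mx_diag (d : 'rV[C]_m) :
  tens_mx n (diag_mx d) = diag_mx (\row_i \prod_k d 0 (idx i k)).
Proof.
apply/matrixP => i j; rewrite !mxE; have [<-|neq_ij] := eqVneq i j.
  by rewrite mulr1n; apply: eq_bigr => k _; rewrite mxE eqxx mulr1n.
have [k neq_k] : exists k, idx i k != idx j k.
  apply/existsP; apply: contraNT neq_ij => /existsPn eq_ij.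
  by apply/eqP/enum_val_inj/ffunP => k; apply/eqP; have := eq_ij k; rewrite negbK.
by rewrite (bigD1 k) //= mxE (negPf neq_k) mulr0n mul0r.
Qed.

(** In an eigenbasis the shift permutes the basis of pure tensors, and only the
fixed words contribute to the trace. *)
Lemma mxtrace_tens_cyc (B : 'M[C]_m) (a : 'I_m -> C) k : B \in unitmx ->
  \tr (tens_mx n (invmx B *m diag_mx (\row_i a i) *m B) *m cyc_mx k) =
    \sum_(w : {ffun 'I_n -> 'I_m}) (\prod_l a (w l)) * (rotw k w == w)%:R.
Proof.
move=> uB; rewrite !tens_mxM -[_ *m tens_mx n B *m _]mulmxA tens_mx_cyc.
rewrite -mulmxA mxtrace_mulC -!mulmxA -tens_mxM mulmxV // tens_mx1 mulmx1.
rewrite tens_mx_diag mul_diag_mx /mxtrace.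
under eq_bigr => i _ do rewrite mxE cyc_mxE eq_sym mxE.
rewrite (sum_tens_basis (fun w : {ffun 'I_n -> 'I_m} =>
  (\prod_l (\row_i a i) 0 (w l)) * (rotw k w == w)%:R)).
by apply: eq_bigr => w _; congr (_ * _); apply: eq_bigr => l _; rewrite mxE.
Qed.

(** The projection on the part of the tensor power on which the generator of the
cyclic group acts as z. *)
Definition cyc_proj (z : C) : 'M[C]_#|{ffun 'I_n -> 'I_m}| :=
  n%:R^-1 *: \sum_(k < n) (z ^+ k)^-1 *: cyc_mx k.

(** As the shift by k acts as z^k on the image of [cyc_proj], every relation is
killed; and 1 - cyc_proj is an explicit combination of relations. *)
Lemma cyc_rel_proj z : n.-primitive_root z ->
  cyc_rel m n z *m cyc_proj z = 0 /\ (1%:M - cyc_proj z <= cyc_rel m n z)%MS.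
Proof.
move=> prim_z; have n_gt0 := prim_order_gt0 prim_z.
have n0 : n%:R != 0 :> C by rewrite pnatr_eq0 -lt0n.
have z0 : z != 0 by rewrite (prim_root_eq0 prim_z) -lt0n.
have cyc1 : cyc_mx 1 *m cyc_proj z = z *: cyc_proj z.
  rewrite -scalemxAr scalerA mulrC -scalerA; congr (_ *: _).
  rewrite mulmx_sumr [in RHS](reindex _ (onW_bij _ (cyc_shift_bij n 1))).
  rewrite scaler_sumr; apply: eq_bigr => k _.
  rewrite -scalemxAr cyc_mxM scalerA cyc_shift_val cyc_mx_mod addnC.
  rewrite (prim_expr_mod prim_z) addn1 exprS invfM mulrA divff //.
  by rewrite mul1r.
have cycX k : cyc_mx k *m cyc_proj z = z ^+ k *: cyc_proj z.
  elim: k => [|k IHk].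
    rewrite expr0 scale1r -[RHS]mul1mx; congr (_ *m _).
    apply/matrixP => i j; rewrite cyc_mxE rotw0 mxE eq_sym.
    by rewrite (inj_eq enum_val_inj).
  by rewrite -add1n -cyc_mxM -mulmxA IHk -scalemxAr cyc1 scalerA exprSr.
split.
  apply/sub_kermxP/sumsmx_subP => k _; apply/sub_kermxP.
  by rewrite mulmxBl cycX mul_scalar_mx subrr.
have -> : 1%:M - cyc_proj z =
    \sum_(k < n) (n%:R^-1 * (z ^+ k)^-1) *: ((z ^+ k)%:M - cyc_mx k).
  under eq_bigr => k _ do rewrite scalerBr -scalemx1 scalerA mulrAC -mulrA
    mulfV ?expf_neq0 // mulr1 -scalerA.
  rewrite sumrB -scaler_sumr; congr (_ - _); last by rewrite -scaler_sumr.
  by rewrite sumr_const card_ord -scaler_nat scalerA mulVf // scale1r.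
apply: summx_sub => k _; apply: scalemx_sub.
exact: (sumsmx_sup k).
Qed.

Variables (gT : finGroupType) (G : {group gT}) (rG : mx_representation C G m).

(** The trace of the projection is an average over the shifts; exchanging the sums
leaves, for each word, the sum of [sum_root_stabilizer]. *)
Lemma char_of_cyc_tens z (g : subg_of G) (B : 'M[C]_m) (a : 'I_m -> C) :
    n.-primitive_root z -> B \in unitmx ->
    rG (sgval g) = invmx B *m diag_mx (\row_i a i) *m B ->
  char_of (cyc_tens_repr n rG z) g = n%:R^-1 *
    \sum_(w : {ffun 'I_n -> 'I_m} | primitive_word w) \prod_l a (w l).
Proof.
move=> prim_z uB rGg; have [relP subP] := cyc_rel_proj prim_z.
rewrite ffunE (mxtrace_factmod_proj _ relP subP) /=; last first.
  rewrite -scalemxAl -scalemxAr mulmx_sumr mulmx_suml; congr (_ *: _).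
  by apply: eq_bigr => k _; rewrite -scalemxAl -scalemxAr tens_mx_cyc.
rewrite -scalemxAr linearZ /= mulmx_sumr raddf_sum; congr (_ * _) => /=.
under eq_bigr => k _ do
  rewrite -scalemxAr linearZ /= rGg mxtrace_tens_cyc // mulr_sumr.
rewrite exchange_big [RHS]big_mkcond; apply: eq_bigr => w _ /=.
under eq_bigr => k _ do rewrite mulrCA.
rewrite -mulr_sumr (sum_root_stabilizer w prim_z).
by case: primitive_word; rewrite ?mulr1 ?mulr0.
Qed.

End CyclicPower.

(** The identity behind part (i).  It holds whatever roots of unity are chosen for
the various e, since primitive words do not involve them. *)
Lemma char_pow_cyc (C : numClosedFieldType) (gT : finGroupType) (G : {group gT})
    m (rG : mx_representation C G m) (zeta : nat -> C) n (g : subg_of G) :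
    (forall e, (0 < e)%N -> e.-primitive_root (zeta e)) -> (0 < n)%N ->
  char_of rG g ^+ n = \sum_(e <- divisors n)
    e%:R * char_of (cyc_tens_repr e rG (zeta e)) (g ^+ (n %/ e))%g.
Proof.
move=> prim_zeta n_gt0; have [B [a [uB _ rGX]]] := repr_diag rG (subgP g).
rewrite -[g in LHS]expg1 (char_of_diag uB rGX).
under eq_bigr => i _ do rewrite expr1.
rewrite sum_words //; apply: eq_big_seq => e; rewrite -dvdn_divisors // => e_n.
have e_gt0 := dvdn_gt0 n_gt0 e_n.
rewrite (char_of_cyc_tens (prim_zeta e e_gt0) uB (a := fun i => a i ^+ (n %/ e))).
  by rewrite mulrA divff ?mul1r // pnatr_eq0 -lt0n.
by rewrite morphX ?inE ?rGX.
Qed.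

(** * Sums over divisors *)

Section DivisorSums.
Variable V : nmodType.

Lemma sum_dvd_divisors (F : nat -> V) k N : (0 < k)%N -> (k <= N)%N ->
  \sum_(1 <= n < N.+1 | (n %| k)%N) F n = \sum_(n <- divisors k) F n.
Proof.
move=> k_gt0 lekN; rewrite -big_filter; apply/perm_big/uniq_perm.
- by rewrite filter_uniq ?iota_uniq.
- exact: divisors_uniq.
move=> n; rewrite mem_filter mem_index_iota -dvdn_divisors //.
apply: andb_idr => n_k; rewrite (dvdn_gt0 k_gt0) //= ltnS.
exact: leq_trans (dvdn_leq k_gt0 n_k) lekN.
Qed.

Lemma sum_divisors_rev (F : nat -> V) n : (0 < n)%N ->
  \sum_(d <- divisors n) F (n %/ d)%N = \sum_(d <- divisors n) F d.
Proof.
move=> n_gt0; rewrite -(big_map (fun d => n %/ d)%N predT F).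
have divK d : (d %| n)%N -> (n %/ (n %/ d))%N = d.
  move=> d_n; rewrite -{1}(divnK d_n) mulKn //.
  by rewrite divn_gt0 ?(dvdn_gt0 n_gt0) // dvdn_leq.
apply/perm_big/uniq_perm; last 2 first.
- exact: divisors_uniq.
- move=> d; rewrite -dvdn_divisors //; apply/mapP/idP => [[c]|d_n].
    by rewrite -dvdn_divisors // => c_n ->; exact: dvdn_div.
  by exists (n %/ d)%N; rewrite ?divK // -dvdn_divisors // dvdn_div.
rewrite map_inj_in_uniq ?divisors_uniq // => c d.
rewrite -!dvdn_divisors // => c_n d_n eq_cd.
by rewrite -(divK c c_n) eq_cd divK.
Qed.

(** The divisors n of k that are multiples of d are the d m with m a divisor of
k / d. *)
Lemma sum_divisors_exchange (F : nat -> nat -> V) k : (0 < k)%N ->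
  \sum_(n <- divisors k) \sum_(d <- divisors n) F n d =
  \sum_(d <- divisors k) \sum_(m <- divisors (k %/ d)) F (d * m)%N d.
Proof.
move=> k_gt0.
transitivity (\sum_(n <- divisors k) \sum_(d <- divisors k | (d %| n)%N) F n d).
  apply: eq_big_seq => n; rewrite -dvdn_divisors // => n_k.
  have n_gt0 := dvdn_gt0 k_gt0 n_k.
  rewrite -[RHS]big_filter; apply/perm_big/uniq_perm.
  - exact: divisors_uniq.
  - by rewrite filter_uniq ?divisors_uniq.
  move=> d; rewrite mem_filter -!dvdn_divisors //.
  by apply/esym/andb_idr => d_n; apply: dvdn_trans n_k.
rewrite (exchange_big_dep predT) //=; apply: eq_big_seq => d.
rewrite -dvdn_divisors // => d_k; have d_gt0 := dvdn_gt0 k_gt0 d_k.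
have kd_gt0 : (0 < k %/ d)%N by rewrite divn_gt0 // dvdn_leq.
rewrite -(big_map (muln d) predT (fun n => F n d)) -[LHS]big_filter.
apply/perm_big/uniq_perm.
- by rewrite filter_uniq ?divisors_uniq.
- rewrite map_inj_uniq ?divisors_uniq // => m m' /eqP.
  by rewrite eqn_pmul2l // => /eqP.
move=> n; rewrite mem_filter -dvdn_divisors //; apply/andP/mapP.
  case=> /dvdnP[m ->] md_k; exists m; last by rewrite mulnC.
  by rewrite -dvdn_divisors // dvdn_divRL // mulnC.
case=> m; rewrite -dvdn_divisors // => m_kd ->; rewrite dvdn_mulr //.
by rewrite mulnC -dvdn_divRL.
Qed.

(** Both sides are the sum of F x y t over all x y t = k. *)
Lemma sum_divisors_triple (F : nat -> nat -> nat -> V) k : (0 < k)%N ->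
  \sum_(n <- divisors k) \sum_(d <- divisors n) F d (k %/ n)%N (n %/ d)%N =
  \sum_(c <- divisors k) \sum_(e <- divisors c) F e (c %/ e)%N (k %/ c)%N.
Proof.
move=> k_gt0.
rewrite (sum_divisors_exchange (fun n d => F d (k %/ n) (n %/ d))%N) //.
rewrite (sum_divisors_exchange (fun c e => F e (c %/ e) (k %/ c))%N) //.
apply: eq_big_seq => d; rewrite -dvdn_divisors // => d_k.
have d_gt0 := dvdn_gt0 k_gt0 d_k.
have kd_gt0 : (0 < k %/ d)%N by rewrite divn_gt0 // dvdn_leq.
rewrite -[RHS]sum_divisors_rev //; apply: eq_big_seq => m.
rewrite -dvdn_divisors // => m_kd.
rewrite !mulKn // !divnMA; congr (F _ _ _).
rewrite -{1}(divnK m_kd) mulKn // divn_gt0 ?(dvdn_gt0 kd_gt0 m_kd) //.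
exact: dvdn_leq.
Qed.
End DivisorSums.

(** * The two systems of Euler factors *)

Section EulerFactors.
Variables (C : numClosedFieldType) (gT : finGroupType) (G : {group gT}).
Variable sG : irrType C G.
Local Notation chi i := (char_of (irr_repr (i : sG))).
Implicit Types (b r : nat -> sG -> C) (g : subg_of G).

(** The coefficient of z^k in - sum_(n,i) b_(n,i) log det (I - rho_i z^n),
evaluated at g. *)
Definition adams_sum b k g : C :=
  \sum_(n <- divisors k) \sum_i b n i * (chi i (g ^+ (k %/ n))%g / (k %/ n)%:R).

(** The coefficient of z^k in - sum_(n,j) r_(n,j) log (1 - chi_j z^n), evaluated
at g. *)
Definition power_sum r k g : C :=
  \sum_(d <- divisors k) \sum_j chi j g ^+ d / d%:R * r (k %/ d)%N j.

Definition cyc_coef (zeta : nat -> C) r n (i : sG) : C :=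
  \sum_(d <- divisors n) \sum_(j : sG)
    char_dot (char_of (cyc_tens_repr d (irr_repr j) (zeta d))) (chi i)
      * r (n %/ d)%N j.

(** Only the n that divide k contribute to the coefficient of z^k, so the limit is
a finite sum. *)
Lemma zseries_adams_sum (L : nat -> gfun C G) b :
    zseries (fun n k =>
      - \sum_(i : sG) b n i *: gfun_log (det_series (irr_repr i) n) k) L ->
  forall k, (0 < k)%N -> forall g, L k g = adams_sum b k g.
Proof.
(* All divisors of k are at most maxn N0 k. *)
move=> hb k k_gt0 g; have [N0 /(_ (maxn N0 k))] := hb k.+1.
rewrite leq_maxl => /(_ isT k (ltnSn k)) <-; rewrite sum_ffunE.
rewrite /adams_sum -(@sum_dvd_divisors _ _ k (maxn N0 k)) ?leq_maxr //.
rewrite [RHS]big_mkcond; apply: eq_big_nat => n /andP[n_gt0 _].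
rewrite ffunE sum_ffunE -sumrN; case: ifP => n_k; last first.
  by rewrite big1 // => i _; rewrite gfunZE log_det_char // n_k mulr0 oppr0.
by apply: eq_bigr => i _; rewrite gfunZE log_det_char // n_k mulrN opprK.
Qed.

(** The term n = k of [adams_sum b k] is a combination of irreducible characters,
which are linearly independent; the other terms are known by induction. *)
Lemma adams_sum_inj b b' N :
    (forall k g, (0 < k <= N)%N -> adams_sum b k g = adams_sum b' k g) ->
  forall n, (0 < n <= N)%N -> b n =1 b' n.
Proof.
move=> eq_bb' n; elim/ltn_ind: n => n IHn /andP[n_gt0 lenN].
apply: irr_free; apply/ffunP => g; have := eq_bb' n g.
rewrite n_gt0 lenN => /(_ isT); rewrite /adams_sum.
rewrite !(bigD1_seq n) ?divisors_id ?divisors_uniq //=.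
rewrite divnn n_gt0 expg1 [X in _ + X = _](_ : _ = \sum_(d <- divisors n | d != n)
   \sum_i b' d i * (chi i (g ^+ (n %/ d))%g / (n %/ d)%:R)).
  move/addIr; rewrite !sum_ffunE => eq_n.
  rewrite -[LHS](_ : \sum_i b n i * (chi i g / 1) = _); last first.
    by apply: eq_bigr => i _; rewrite divr1 gfunZE.
  by rewrite eq_n; apply: eq_bigr => i _; rewrite divr1 gfunZE.
rewrite big_seq_cond [RHS]big_seq_cond; apply: eq_bigr => d.
rewrite -dvdn_divisors // => /andP[d_n neq_dn]; apply: eq_bigr => i _.
have led_n := dvdn_leq n_gt0 d_n.
by rewrite IHn ?(dvdn_gt0 n_gt0 d_n) ?(leq_trans led_n) // ltn_neqAle neq_dn.
Qed.

(** After expanding chi_j(g)^c by [char_pow_cyc], both sides are sums over triples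
of product k. *)
Lemma adams_sum_cyc zeta r k g :
    (forall d, (0 < d)%N -> d.-primitive_root (zeta d)) -> (0 < k)%N ->
  adams_sum (cyc_coef zeta r) k g = power_sum r k g.
Proof.
move=> prim_zeta k_gt0.
pose cyc d j h : C := char_of (cyc_tens_repr d (irr_repr (j : sG)) (zeta d)) h.
have coefE n h : \sum_i cyc_coef zeta r n i * chi i h =
    \sum_(d <- divisors n) \sum_j cyc d j h * r (n %/ d)%N j.
  under eq_bigr => i _ do rewrite mulr_suml; rewrite exchange_big.
  apply: eq_bigr => d _ /=; under eq_bigr => i _ do rewrite mulr_suml.
  rewrite exchange_big; apply: eq_bigr => j _ /=.
  rewrite /cyc (char_of_dot sG (cyc_tens_repr _ _ _)) sum_ffunE mulr_suml.
  by apply: eq_bigr => i _; rewrite gfunZE mulrAC -char_of_dot.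
pose F d m e : C := \sum_j cyc d j (g ^+ m)%g * r e j / m%:R.
transitivity (\sum_(n <- divisors k) \sum_(d <- divisors n) F d (k %/ n)%N (n %/ d)%N).
  apply: eq_bigr => n _; under eq_bigr => i _ do rewrite mulrA.
  rewrite -mulr_suml coefE mulr_suml; apply: eq_bigr => d _.
  by rewrite /F -mulr_suml.
rewrite sum_divisors_triple //; apply: eq_big_seq => c.
rewrite -dvdn_divisors // => c_k; have c_gt0 := dvdn_gt0 k_gt0 c_k.
rewrite exchange_big; apply: eq_bigr => j _ /=.
rewrite (char_pow_cyc (irr_repr j) g prim_zeta c_gt0) !mulr_suml.
apply: eq_big_seq => e; rewrite -dvdn_divisors // => e_c.
have e_gt0 := dvdn_gt0 c_gt0 e_c.
have e0 : e%:R != 0 :> C by rewrite pnatr_eq0 -lt0n.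
have c_eq : c%:R = (c %/ e)%:R * e%:R :> C by rewrite -natrM divnK.
rewrite c_eq invfM -/(cyc e j _) mulrAC; congr (_ * _).
by rewrite [e%:R * _]mulrC -mulrA [e%:R * _]mulrC divfK.
Qed.

(** The bound N serves part (ii), where a different r is built for each N. *)
Lemma log_coef_eq_cyc_coef (L : nat -> gfun C G) b r zeta N :
    (forall d, (0 < d)%N -> d.-primitive_root (zeta d)) ->
    zseries (fun n k =>
      - \sum_(i : sG) b n i *: gfun_log (det_series (irr_repr i) n) k) L ->
    (forall k g, (0 < k <= N)%N -> L k g = power_sum r k g) ->
  forall n, (0 < n <= N)%N -> b n =1 cyc_coef zeta r n.
Proof.
move=> prim_zeta hb Lr; apply: adams_sum_inj => k g /[dup] k_le /andP[k_gt0 _].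
by rewrite adams_sum_cyc // -Lr // (zseries_adams_sum hb).
Qed.

(** The multiplicities of the chi_i in gamma^(tensor d) add up to the character
chi_gamma^d. *)
Lemma power_sum_recursion (L : nat -> gfun C G) (q r : nat -> sG -> C) :
    (forall n, (0 < n)%N -> L n = \sum_(i : sG) q n i *: chi i) ->
    (forall i, r 1%N i = q 1%N i) ->
    (forall n, (1 < n)%N -> forall i : sG,
      r n i = q n i - \sum_(d <- divisors n | (1 < d)%N) \sum_(j : sG)
        char_dot (char_of (tens_repr d (irr_repr j))) (chi i)
          / d%:R * r (n %/ d)%N j) ->
  forall k g, (0 < k)%N -> L k g = power_sum r k g.
Proof.
move=> Lq r1 rS k g k_gt0; rewrite Lq // sum_ffunE /power_sum.
(* The recursion, solved for q and including k = 1, where the sum is empty. *)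
have def_q i : q k i = r k i + \sum_(d <- divisors k | d != 1%N) \sum_j
    char_dot (char_of (tens_repr d (irr_repr j))) (chi i) / d%:R * r (k %/ d)%N j.
  have [k1 | k_gt1] := leqP k 1.
    have -> : k = 1%N by apply/eqP; rewrite eqn_leq k1.
    by rewrite r1 [divisors 1]/= big_cons big_nil addr0.
  rewrite rS // -[LHS](subrK (\sum_(d <- divisors k | (1 < d)%N) \sum_j
    char_dot (char_of (tens_repr d (irr_repr j))) (chi i) / d%:R * r (k %/ d)%N j)).
  congr (_ + _); rewrite big_seq_cond [RHS]big_seq_cond; apply: eq_bigl => d.
  apply: andb_id2l; rewrite -dvdn_divisors // => /(dvdn_gt0 k_gt0).
  by case: d => [|[]].
rewrite (bigD1_seq 1%N) ?divisor1 ?divisors_uniq //=.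
under eq_bigr => i _ do rewrite gfunZE def_q mulrDl.
rewrite big_split /=; congr (_ + _).
  by apply: eq_bigr => j _; rewrite expr1 divr1 divn1 mulrC.
under eq_bigr => i _ do rewrite mulr_suml; rewrite exchange_big /=.
apply: eq_bigr => d _; under eq_bigr => i _ do rewrite mulr_suml.
rewrite exchange_big /=; apply: eq_bigr => j _.
rewrite -char_of_tens (char_of_dot sG (tens_repr _ _)) sum_ffunE !mulr_suml.
apply: eq_bigr => i _; rewrite gfunZE -char_of_dot.
by rewrite [LHS]mulrAC; congr (_ * _); rewrite mulrAC.
Qed.

(** * Integrality *)

(** Logarithms of the integral series with constant term 1.  They form an additive
group, which is easier to handle than the multiplicative group of the series:
products of Euler factors become sums. *)
Definition int_log (l : nat -> gfun C G) := exists f : nat -> gfun C G,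
  [/\ f 0%N = 1, forall n, in_RGZ sG (f n) & forall n, l n = gfun_log f n].

Lemma int_log0 : int_log (fun=> 0).
Proof.
exists (fun n => (n == 0%N)%:R); split=> // n.
  case: eqP => _; first exact: in_RGZ1.
  exact: in_RGZ0.
apply/ffunP => g; rewrite !ffunE -[LHS](ps_log1 C n); apply: eq_ps_log => // k.
by rewrite /ps_one; case: eqP => _; rewrite ffunE.
Qed.

Lemma int_logD l l' : int_log l -> int_log l' -> int_log (fun n => l n + l' n).
Proof.
move=> [f [f0 fZ lE]] [f' [f'0 f'Z l'E]].
exists (fun n => \sum_(i < n.+1) f i * f' (n - i)%N); split=> [|n|n].
- by rewrite big_ord1 f0 f'0 mulr1.
- by apply: in_RGZ_sum => i; apply: in_RGZM.
apply/ffunP => g; rewrite lE l'E !ffunE -ps_logM ?f0 ?f'0 ?ffunE //.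
apply: eq_ps_log => [|k]; first by rewrite /ps_mul big_ord1 f0 f'0 ffunE mulr1.
by rewrite sum_ffunE; apply: eq_bigr => i _; rewrite ffunE.
Qed.

(** The series - log (1 - chi_i z^m). *)
Definition log_geom_char (i : sG) m n : gfun C G :=
  [ffun g => log_geom (chi i g : C) m n].

Lemma int_log_geom i m : (0 < m)%N -> int_log (log_geom_char i m).
Proof.
move=> m_gt0; exists (fun n => if (m %| n)%N then chi i ^+ (n %/ m) else 0).
split=> [|n|n]; first by rewrite dvdn0 div0n expr0.
  case: ifP => _; last exact: in_RGZ0.
  by apply/in_RGZX/in_RGZ_char.
apply/ffunP => g; rewrite !ffunE -(ps_log_geom _ m_gt0).
apply: eq_ps_log => [|k]; first by rewrite /ps_geom dvdn0 div0n expr0.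
by rewrite /ps_geom; case: ifP => _; rewrite ?gfunXE ?ffunE.
Qed.

Lemma int_log_geomN i m : (0 < m)%N -> int_log (fun n => - log_geom_char i m n).
Proof.
move=> m_gt0; pose c n : int := (n == 0%N)%:R; pose d n : int := - (n == m)%:R.
exists (fun n => (c n)%:~R *: (1 : gfun C G) + (d n)%:~R *: chi i); split=> [|n|n].
- by rewrite /c /d (ltn_eqF m_gt0) eqxx oppr0 scale0r addr0 scale1r.
- have := in_RGZ_comb (sG := sG) (fun x : bool => if x then c n else d n)
    (f := fun x : bool => if x then 1 : gfun C G else chi i).
  rewrite big_bool; apply; case; [exact: in_RGZ1 | exact: in_RGZ_char].
apply/ffunP => g; rewrite !ffunE -(ps_log_binom _ m_gt0).
apply: eq_ps_log => [|k]; first exact: coef0_binom.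
rewrite coefB coef1 coefZ coefXn ffunE !gfunZE ffunE mulr1 mulrC.
by rewrite /c /d rmorphN !rmorph_nat mulNr ffunE.
Qed.

Lemma int_logMz l (z : int) :
    int_log l -> int_log (fun n => - l n) -> int_log (fun n => z%:~R *: l n).
Proof.
have pos l' k : int_log l' -> int_log (fun n => k%:R *: l' n).
  move=> lZ; elim: k => [|k IHk].
    rewrite (_ : (fun n => _) = fun=> 0); first exact: int_log0.
    by apply/funext => n; rewrite scale0r.
  rewrite (_ : (fun n => _) = fun n => l' n + k%:R *: l' n); first exact: int_logD.
  by apply/funext => n; rewrite mulrS scalerDl scale1r.
case: z => k lZ lNZ; first exact: pos.
rewrite (_ : (fun n => _) = fun n => k.+1%:R *: - l n); first exact: pos.
by apply/funext => n; rewrite NegzE rmorphN scaleNr scalerN.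
Qed.

Lemma int_log_sum (I : Type) (s : seq I) (P : pred I) (l : I -> nat -> gfun C G) :
  (forall i, P i -> int_log (l i)) -> int_log (fun n => \sum_(i <- s | P i) l i n).
Proof.
move=> lZ; elim: s => [|i s IHs].
  rewrite (_ : (fun n => _) = fun=> 0); first exact: int_log0.
  by apply/funext => n; rewrite big_nil.
have [Pi|nPi] := boolP (P i).
  rewrite (_ : (fun n => _) = fun n => l i n + \sum_(i <- s | P i) l i n).
    by apply: int_logD => //; apply: lZ.
  by apply/funext => n; rewrite big_cons Pi.
rewrite (_ : (fun n => _) = fun n => \sum_(i <- s | P i) l i n) //.
by apply/funext => n; rewrite big_cons (negPf nPi).
Qed.

(** If log f starts in degree n, then so does f - 1, with the same coefficient;
this follows from f * (log f)' = f' in degree n - 1. *)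
Lemma int_log_lead l n : int_log l -> (0 < n)%N ->
  (forall k, (0 < k < n)%N -> l k = 0) -> in_RGZ sG (l n).
Proof.
move=> [f [f0 fZ lE]]; case: n => // n _ l0; suff -> : l n.+1 = f n.+1 by [].
apply/ffunP => g; pose h k : C := f k g.
have h0 : h 0%N = 1 by rewrite /h f0 ffunE.
have lgE k : l k g = ps_log h k by rewrite lE ffunE.
have := ps_log_deriv h0 n; rewrite /ps_mul big_ord_recl h0 mul1r subn0.
rewrite big1 ?addr0 => [|i _].
  by rewrite /ps_deriv -lgE => /eqP; rewrite eqrMn2r /= => /eqP.
rewrite /ps_deriv -lgE l0 ?ffunE ?mul0rn ?mulr0 //=.
by rewrite ltnS ltn_subrL (leq_ltn_trans _ (ltn_ord i)).
Qed.

(** Once the terms with m <= N are subtracted, the coefficient of z^(N+1) is an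
integral combination of the chi_j, and these coefficients are the r_(N+1,j). *)
Lemma int_log_expansion l N : int_log l -> l 0%N = 0 ->
  exists r : nat -> sG -> int, forall n, (n <= N)%N ->
    l n = \sum_(1 <= m < N.+1) \sum_j (r m j)%:~R *: log_geom_char j m n.
Proof.
move=> lZ l0; elim: N => [|N [r rE]].
  by exists (fun _ _ => 0) => n; rewrite leqn0 big_geq // => /eqP->.
pose l' n := l n + \sum_(1 <= m < N.+1) \sum_j
  (- r m j)%:~R *: log_geom_char j m n.
have l'E n : l' n = l n - \sum_(1 <= m < N.+1) \sum_j
    (r m j)%:~R *: log_geom_char j m n.
  rewrite /l' -sumrN; congr (_ + _); apply: eq_bigr => m _; rewrite -sumrN.
  by apply: eq_bigr => j _; rewrite rmorphN scaleNr.
have l'Z : int_log l'.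
  apply: int_logD => //; rewrite (_ : (fun n => _) = fun n =>
    \sum_(m <- index_iota 1 N.+1 | (0 < m)%N) \sum_j
      (- r m j)%:~R *: log_geom_char j m n).
    apply: int_log_sum => m m_gt0; apply: int_log_sum => j _.
    by apply: int_logMz; [apply: int_log_geom | apply: int_log_geomN].
  apply/funext => n; rewrite big_nat_cond [RHS]big_seq_cond.
  apply: eq_bigl => m; rewrite mem_index_iota andbT.
  by case: m => [|m]; rewrite /= ?andbF ?andbT.
have [|k /andP[_ lekN]|c l'N] := int_log_lead (n := N.+1) l'Z => //.
  by rewrite l'E rE ?subrr // -ltnS.
exists (fun m j => if m == N.+1 then c j else r m j) => n lenN.
have -> : l n = l' n + \sum_(1 <= m < N.+1) \sum_j
    (r m j)%:~R *: log_geom_char j m n by rewrite l'E subrK.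
rewrite [RHS]big_nat_recr //= eqxx addrC; congr (_ + _); last first.
  apply: eq_big_nat => m /andP[_ ltmN]; apply: eq_bigr => j _.
  by rewrite ltn_eqF.
have [-> | neq_n] := eqVneq n N.+1.
  rewrite l'N; apply: eq_bigr => j _; congr (_ *: _); apply/ffunP => g.
  by rewrite [RHS]ffunE /log_geom dvdnn divnn /= expr1 divr1.
have ltnN : (n < N.+1)%N by rewrite ltn_neqAle neq_n.
rewrite l'E rE // subrr big1 // => j _.
rewrite (_ : log_geom_char j N.+1 n = 0) ?scaler0 //; apply/ffunP => g.
rewrite !ffunE /log_geom; have [->|n_gt0] := posnP n.
  by rewrite dvdn0 div0n invr0 mulr0.
by rewrite gtnNdvd.
Qed.

Lemma power_sum_log_geom (r : nat -> sG -> int) n N g :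
    (0 < n)%N -> (n <= N)%N ->
  (\sum_(1 <= m < N.+1) \sum_j (r m j)%:~R *: log_geom_char j m n) g =
  power_sum (fun m j => (r m j)%:~R) n g.
Proof.
move=> n_gt0 lenN; rewrite /power_sum -sum_divisors_rev //.
rewrite -(sum_dvd_divisors _ n_gt0 lenN) sum_ffunE [RHS]big_mkcond.
apply: eq_big_nat => m /andP[m_gt0 _]; rewrite sum_ffunE; case: ifP => m_n.
  apply: eq_bigr => j _; rewrite gfunZE ffunE /log_geom m_n mulrC.
  have -> // : (n %/ (n %/ m) = m)%N.
  by rewrite -{1}(divnK m_n) mulKn // divn_gt0 // dvdn_leq.
by rewrite big1 // => j _; rewrite gfunZE ffunE /log_geom m_n mulr0.
Qed.

Lemma cyc_coef_int zeta (r : nat -> sG -> int) n i :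
  exists z : int, cyc_coef zeta (fun m j => (r m j)%:~R) n i = z%:~R.
Proof.
pose m d j := projT1 (cid (char_dot_nat
  (cyc_tens_repr d (irr_repr (j : sG)) (zeta d)) i)).
exists (\sum_(d <- divisors n) \sum_j (m d j)%:Z * r (n %/ d)%N j).
rewrite rmorph_sum; apply: eq_bigr => d _; rewrite rmorph_sum.
apply: eq_bigr => j _; rewrite rmorphM; congr (_ * _).
by rewrite /m; case: cid => k /= ->.
Qed.

(** An integral r that is correct up to degree N exists by [int_log_expansion], and
part (i) turns it into b_(N,i) with natural numbers as multiplicities. *)
Lemma log_coef_int (Q : nat -> gfun C G) b :
    Q 0%N = 1 -> (forall n, in_RGZ sG (Q n)) ->
    zseries (fun n k =>
      - \sum_(i : sG) b n i *: gfun_log (det_series (irr_repr i) n) k)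
      (gfun_log Q) ->
  forall n, (0 < n)%N -> forall i : sG, exists z : int, b n i = z%:~R.
Proof.
move=> Q0 QZ hb N N_gt0 i.
have /choice[zeta prim_zeta] :
    forall d, exists z : C, (0 < d)%N -> d.-primitive_root z => [d|].
  by have [->|/(prim_root_exists C)[z]] := posnP d; [exists 0 | exists z].
have [||r rE] := @int_log_expansion (gfun_log Q) N; first by exists Q.
  by apply/ffunP => g; rewrite !ffunE /ps_log big_geq.
have [z def_z] := cyc_coef_int zeta r N i; exists z; rewrite -def_z.
apply: (log_coef_eq_cyc_coef (N := N) prim_zeta hb) => [k g /andP[k_gt0 lekN]|].
  by rewrite rE // power_sum_log_geom.
by rewrite N_gt0 leqnn.
Qed.

End EulerFactors.

(** * The exponents of the Euler product *)

Theorem theorem13p4 (R : realType) (E : splittingFieldType rat)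
    (galE : galois 1%AS {: E}) (sG : irrType R[i] ('Gal({: E} / 1%AS))%G)
    (Q : nat -> gfun R[i] ('Gal({: E} / 1%AS))%G)
    (Q0 : Q 0%N = 1) (QR : forall n, in_RG sG (Q n))
    (b : nat -> sG -> R[i])
    (hb : zseries
      (fun n k => - \sum_(i : sG) b n i *: gfun_log (det_series (irr_repr i) n) k)
      (gfun_log Q)) :
  (forall (q r : nat -> sG -> R[i]) (zeta : nat -> R[i]),
    (forall n, (0 < n)%N ->
      gfun_log Q n = \sum_(i : sG) q n i *: char_of (irr_repr i)) ->
    (forall i : sG, r 1%N i = q 1%N i) ->
    (forall n, (1 < n)%N -> forall i : sG,
      r n i = q n i - \sum_(d <- divisors n | (1 < d)%N) \sum_(j : sG)
        char_dot (char_of (tens_repr d (irr_repr j))) (char_of (irr_repr i))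
          / d%:R * r (n %/ d)%N j) ->
    (forall d, (0 < d)%N -> d.-primitive_root (zeta d)) ->
    forall n, (0 < n)%N -> forall i : sG,
      b n i = \sum_(d <- divisors n) \sum_(j : sG)
        char_dot (char_of (cyc_tens_repr d (irr_repr j) (zeta d)))
                 (char_of (irr_repr i)) * r (n %/ d)%N j)
  /\
  ((forall n, in_RGZ sG (Q n)) ->
    forall n, (0 < n)%N -> forall i : sG, exists z : int, b n i = z%:~R).
Proof.
split=> [q r zeta Lq r1 rS prim_zeta n n_gt0 i|QZ].
  apply: (log_coef_eq_cyc_coef (N := n) prim_zeta hb) => [k g /andP[k_gt0 _]|].
    exact: power_sum_recursion Lq r1 rS k g k_gt0.
  by rewrite n_gt0 leqnn.
exact: log_coef_int Q0 QZ hb.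
Qed.
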